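(* Fix a positive integer $r$ and one of the six models. There is a constant $C$ (depending on the model and $r$, not on $N,N_1,N_2$) such that for every $N_1,N_2$ with $N=N_1+N_2$ and $N_1r/K$, $N_2r/K$ integers, $$\mathbb{E}\big[H(\mathbb{G}(N,r))\big]\ge\mathbb{E}\big[H(\mathbb{G}(N_1,r))\big]+\mathbb{E}\big[H(\mathbb{G}(N_2,r))\big]-CN^{5/6}.$$
   Context: Let $K\ge2$, $\chi=\{0,\dots,q-1\}$. For $n$ with $nr/K\in\mathbb{Z}$, $\mathbb{G}(n,r)$ is the configuration-model random $r$-regular hypergraph on $n$ nodes: each node gets $r$ points, a uniformly random partition of the $nr$ points into blocks of size $K$ is chosen, and each block is projected to the hyperedge formed by the owners of its points. For a hypergraph $G$, $H(x)=\sum_iH_i(x_i)+\sum_{e\in E}H_e(x_e)$ and $H(G)=\max_xH(x)$. Models: Independent set ($K=2,q=2$, $H_i(1)=1,H_i(0)=0$, $H_e(1,1)=-\infty$, else $0$); MAX-CUT ($K=2,q=2$, $H_i\equiv0$, $H_e(x,y)=\mathbf 1[x\ne y]$); anti-ferromagnetic Ising ($K=2,q=2$, fixed $\beta>0,B\in\mathbb{R}$, $H_i(0)=-B,H_i(1)=B$, $H_e(x,y)=-\beta$ if $x=y$, $\beta$ otherwise); $q$-Coloring ($K=2$, $H_i\equiv0$, $H_e(x,y)=\mathbf 1[x\ne y]$); K-SAT ($q=2$, $H_i\equiv0$, independent uniform $a_e\in\{0,1\}^K$, $H_e(a_e)=0$, $1$ otherwise); NAE-K-SAT ($H_e(a_e)=H_e(\mathbf1-a_e)=0$,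 $1$ otherwise). *)

(* Defs.v *)
From HB Require Import structures.
From mathcomp Require Import all_boot all_order all_algebra.
From mathcomp Require Import all_classical all_reals all_analysis.
Set Implicit Arguments. Unset Strict Implicit. Unset Printing Implicit Defensive.
Import Order.TTheory GRing.Theory Num.Theory.
Local Open Scope ring_scope.

Inductive model (R : realType) :=
| IndSet
| MaxCut
| Ising of R & R
| Coloring of nat
| KSAT of nat
| NAEKSAT of nat.
Arguments IndSet {R}. Arguments MaxCut {R}.

Section Models.
Variable R : realType.

Definition mK (m : model R) : nat :=
  match m with KSAT K | NAEKSAT K => K | _ => 2%N end.
Definition mq (m : model R) : nat :=
  match m with Coloring q => q | _ => 2%N end.

Definition model_ok (m : model R) : Prop :=
  match m with
  | Ising beta _ => 0 < beta
  | Coloring q => (0 < q)%N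
  | KSAT K | NAEKSAT K => (2 <= K)%N
  | _ => True
  end.

(* points of the configuration model on n nodes: node i owns points (i,j), j<r *)
Notation points n r := (prod (ordinal n) (ordinal r)).

Definition block_partitions (n r K : nat) :=
  finset (fun P : {set {set points n r}} =>
     finset.partition P [set: points n r] && [forall B in P, #|B| == K]).

Definition Hvert (m : model R) (v : nat) : \bar R :=
  match m with
  | IndSet => (if v == 1%N then 1 else 0)%:E
  | Ising _ B => (if v == 1%N then B else - B)%:E
  | _ => 0%E
  end.

(* H_e for the hyperedge obtained from block Bl: y p is the spin x_{owner p}
   of the owner of point p, and a p is the (random) literal sign attached to
   point p (only used by K-SAT / NAE-K-SAT, where a_e = (a p)_{p in Bl}). *)
Definition Hedge (m : model R) n r (Bl : {set points n r})
    (y : points n r -> nat) (a : points n r -> bool) : \bar R :=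
  let allequal := [forall p in Bl, [forall p' in Bl, y p == y p']] in
  match m with
  | IndSet => if [forall p in Bl, y p == 1%N] then -oo%E else 0%E
  | MaxCut | Coloring _ => (if allequal then 0 else 1)%:E
  | Ising beta _ => (if allequal then - beta else beta)%:E
  | KSAT _ => (if [forall p in Bl, y p == nat_of_bool (a p)] then 0 else 1)%:E
  | NAEKSAT _ =>
      (if [forall p in Bl, y p == nat_of_bool (a p)]
          || [forall p in Bl, y p == nat_of_bool (~~ a p)] then 0 else 1)%:E
  end.

Definition Hx (m : model R) n r (P : {set {set points n r}})
    (a : {ffun points n r -> bool}) (x : {ffun 'I_n -> 'I_(mq m)}) : \bar R :=
  ((\sum_(i : 'I_n) Hvert m (x i)) +
   (\sum_(Bl in P) Hedge m Bl (fun p => nat_of_ord (x p.1)) a))%E.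

Definition HG (m : model R) n r (P : {set {set points n r}})
    (a : {ffun points n r -> bool}) : \bar R :=
  (\big[maxe/-oo]_(x : {ffun 'I_n -> 'I_(mq m)}) @Hx m n r P a x)%E.

(* E[H(G(n,r))]: uniform average over the block partitions and over the
   independent uniform signs (the signs are ignored by the non-SAT models). *)
Definition EH (m : model R) (n r : nat) : \bar R :=
  let Om := block_partitions n r (mK m) in
  let w : R := ((#|Om| * #|{ffun points n r -> bool}|)%:R)^-1 in
  (\sum_(P in Om) \sum_(a : {ffun points n r -> bool}) w%:E * HG m P a)%E.

End Models.

(* Main.v *)
(* Fix the literal signs. For a family P of disjoint blocks of points, average the optimum
   over the permutations of the points that preserve the two clusters U and ~U. This
   average Phi(P) depends only on how many points each block has in U, so the averages
   over internal families (no block meeting both clusters) and over all families can be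
   compared through Phi, one family at a time.

   Each layer of the change of the optimum caused by one extra block A + {x, y} is a
   constant minus the indicator of "the block is bad for every assignment of a level set",
   which as a kernel in (x, y) is positive semidefinite. Testing it against the difference
   of the uniform distributions on the free points of the two clusters shows that Phi at a
   crossing block A + {p, q} is at least the mean of its values at A + {p, p'} and A + {q,
   q'}, up to an error inversely proportional to the number of free points.

   The induced random walk preserves the mean of crossing(P) + (deviation of the number of
   occupied points of U)^2, so a maximum principle for Phi plus a small multiple of this
   quantity compares any family with an internal one. Freeing M points on each side at the
   start costs O(M), the walk costs O(N/M + N^2/M^2), and M of order N^(5/6) is enough. *)
Require Import Defs.
From HB Require Import structures.
From mathcomp Require Import all_boot all_order all_fingroup all_algebra.
From mathcomp Require Import zify ring lra.
Set Implicit Arguments. Unset Strict Implicit. Unset Printing Implicit Defensive.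
Import Order.TTheory GRing.Theory Num.Theory.
Local Open Scope ring_scope.

(** * Permutations preserving a cluster *)

Section Relabelling.
Variable T : finType.
Implicit Types (s t : {perm T}) (U A B D E : {set T}) (P Q : {set {set T}}).

Definition relabel s P : {set {set T}} := [set s @: (B : {set T}) | B in P].

(** The setwise stabiliser of [U]. Since it is a group, translating by one of its elements only
    permutes the terms of an average over it. *)
Definition side_perms U : {set {perm T}} := ('N(U | 'P))%g.

Lemma side_permsP U s :
  reflect (forall x, (s x \in U) = (x \in U)) (s \in side_perms U).
Proof.
by apply: (iffP astabsP) => h x; rewrite -[RHS]h.
Qed.

Lemma side_perms_gt0 U : (0 < #|side_perms U|)%N.
Proof. by apply/card_gt0P; exists 1%g; apply/side_permsP => x; rewrite perm1. Qed.

Lemma mem_side_permsM U s t :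
  t \in side_perms U -> ((t * s)%g \in side_perms U) = (s \in side_perms U).
Proof. by move=> ht; rewrite /side_perms groupMl. Qed.

Lemma tperm_side_perms U x y :
  (x \in U) = (y \in U) -> tperm x y \in side_perms U.
Proof.
move=> xy; apply/side_permsP => z.
by case: tpermP => [->|->|//]; rewrite xy.
Qed.

Lemma imset_perm_inj s : injective (fun B : {set T} => s @: B).
Proof. exact/imset_inj/perm_inj. Qed.

Lemma relabelM s t P : relabel s (relabel t P) = relabel (t * s)%g P.
Proof.
rewrite /relabel -imset_comp; apply: eq_imset => B /=.
by rewrite -imset_comp; apply: eq_imset => x /=; rewrite permM.
Qed.

Lemma relabel_inj s : injective (relabel s).
Proof. exact/imset_inj/imset_perm_inj. Qed.

Lemma card_relabel s P : #|relabel s P| = #|P|.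
Proof. exact/card_imset/imset_perm_inj. Qed.

Lemma relabelU1 s B P : relabel s (B |: P) = (s @: B) |: relabel s P.
Proof. by rewrite /relabel imsetU1. Qed.

Lemma mem_relabel s B P : (s @: B \in relabel s P) = (B \in P).
Proof. by rewrite /relabel (mem_imset _ _ (@imset_perm_inj s)). Qed.

Lemma imset_fix s B : (forall x, x \in B -> s x = x) -> s @: B = B.
Proof. by move=> h; rewrite (eq_in_imset h) imset_id. Qed.

Lemma relabel_fix s P : (forall x, x \in cover P -> s x = x) -> relabel s P = P.
Proof.
move=> h; rewrite /relabel -[RHS]imset_id; apply: eq_in_imset => B BP.
by apply: imset_fix => x xB; apply: h; apply/bigcupP; exists B.
Qed.

Lemma cover_relabel s P : cover (relabel s P) = s @: cover P.
Proof. by rewrite cover_imset imset_cover. Qed.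

Lemma card_perm_setI U s B : s \in side_perms U -> #|s @: B :&: U| = #|B :&: U|.
Proof.
move=> /side_permsP hs.
have -> : s @: B :&: U = s @: (B :&: U).
  apply/setP => x; rewrite inE; apply/andP/imsetP => [[/imsetP[y yB ->]]|[y]].
    by rewrite hs => yU; exists y; rewrite ?inE ?yB.
  by rewrite inE => /andP[yB yU] ->; rewrite hs; split=> //; apply: imset_f.
by rewrite card_imset //; apply: perm_inj.
Qed.

Lemma card_setU2I A V x y : x != y -> x \notin A -> y \notin A ->
  #|(x |: (y |: A)) :&: V| = ((x \in V) + (y \in V) + #|A :&: V|)%N.
Proof.
move=> xy xA yA; rewrite !setIUl.
have h1 z : [set z] :&: V = if z \in V then [set z] else set0.
  case: ifP => zV; first by apply/setIidPl; rewrite sub1set.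
  by apply/setP => t; rewrite !inE; case: eqP => // ->.
by rewrite !h1; case: ifP => xV; case: ifP => yV;
  rewrite ?set0U ?cardsU1 ?inE ?(negPf xA) ?(negPf yA) ?(negPf xy).
Qed.

(* Transpositions of a point of [E] with a point of [E'] on the same side move [E] onto
   [E'] step by step. *)
Lemma perm_same_type U E E' :
  #|E| = #|E'| -> #|E :&: U| = #|E' :&: U| ->
  exists2 s, s \in side_perms U &
    s @: E = E' /\ forall x, x \notin E :|: E' -> s x = x.
Proof.
have [k] := ubnP #|E :\: E'|; elim: k E => // k IH E lek cE cEU.
have [sub|/subsetPn[x xE xE']] := boolP (E \subset E').
  have -> : E' = E by apply/esym/eqP; rewrite eqEcard sub cE leqnn.
  exists 1%g; first by apply/side_permsP => x; rewrite perm1.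
  by split=> [|x _]; rewrite ?perm1 // imset_fix // => x _; rewrite perm1.
(* [V] is the side of [x]. Both sets have equally many points in [V], and [x] lies in [E] only, so
   [V] also holds a point of [E'] only. *)
have [y yE' /andP[yE xy]] : exists2 y, y \in E' & (y \notin E) && ((x \in U) == (y \in U)).
  pose V := if x \in U then U else ~: U.
  have xV : x \in V by rewrite /V; case: ifP => //; rewrite inE => ->.
  have cV : #|E :&: V| = #|E' :&: V|.
    rewrite /V; case: ifP => // _.
    have := cardsID U E; have := cardsID U E'; rewrite !setDE; lia.
  have /subsetPn[y] : ~~ (E' :&: V \subset E :&: V).
    apply/negP => sub; have /eqP eEV : E' :&: V == E :&: V by rewrite eqEcard sub cV leqnn.
    by move/setP: eEV => /(_ x); rewrite !inE xE xV (negPf xE').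
  rewrite !inE => /andP[yE' yV]; rewrite yV andbT => yE; exists y => //.
  rewrite yE /=; move: yV; rewrite /V; case: ifP => _; first by move=> ->.
  by rewrite inE => /negPf ->.
have xNy : x != y by apply: contraNneq xE' => ->.
pose E2 := y |: (E :\ x).
have tE : tperm x y @: E = E2.
  apply/setP => z; apply/imsetP/idP => [[w wE ->]|].
    rewrite !inE; case: tpermP => [_|wy|/eqP wx /eqP wy].
    - by rewrite eqxx.
    - by rewrite wy (negPf yE) in wE.
    - by rewrite wx wE orbT.
  rewrite !inE => /orP[/eqP ->|/andP[zx zE]]; first by exists x => //; rewrite tpermL.
  by exists z => //; rewrite tpermD // eq_sym //; apply: contraNneq yE => <-.
have tU : tperm x y \in side_perms U by apply/tperm_side_perms/eqP.
have cE2 : #|E2| = #|E| by rewrite -tE card_imset //; apply: perm_inj.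
have cE2U : #|E2 :&: U| = #|E :&: U| by rewrite -tE card_perm_setI.
have [||| s sU [sE sfix]] := IH E2.
- rewrite -ltnS (leq_trans _ lek) // ltnS; apply: proper_card; apply/properP; split.
    apply/subsetP => z; rewrite !inE => /andP[zE' /orP[/eqP zy|/andP[_ ->]]].
      by rewrite zy yE' in zE'.
    by rewrite zE'.
  by exists x; rewrite !inE ?xE ?xE' // eqxx (negPf xNy).
- by rewrite cE2.
- by rewrite cE2U.
exists (tperm x y * s)%g; first by rewrite mem_side_permsM.
split=> [|z].
  by rewrite -sE -tE -imset_comp; apply: eq_imset => z; rewrite /= permM.
rewrite !inE negb_or permM => /andP[zE zE'].
have zx : x != z by apply: contraNneq zE => <-.
have zy : y != z by apply: contraNneq zE' => <-.
by rewrite tpermD // sfix // !inE (eq_sym z) (negPf zy) (negPf zE) (negPf zE') andbF.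
Qed.

End Relabelling.

(** * The symmetrized functional *)

Section SymmetrizedFunctional.
Variables (R : realFieldType) (T : finType) (U : {set T}).
Variables (h : {set {set T}} -> R) (c hi : R).
Implicit Types (s t : {perm T}) (A B D E : {set T}) (P Q : {set {set T}}).

Hypothesis h_add_ge : forall B P, B \notin P -> h P - c <= h (B |: P).
Hypothesis h_add_le : forall B P, B \notin P -> h (B |: P) <= h P + hi.
(** A negative-type condition on the gain of a block, seen as a kernel in two of its points. The
    diagonal is left out because equal points would give a smaller block; the right-hand side pays
    for it. *)
Hypothesis h_negtype : forall Q A D (v : T -> R),
  (forall x, x \in D -> x \notin cover Q) ->
  \sum_(x in D) \sum_(y in D | y != x)
     v x * v y * (h ((x |: (y |: A)) |: Q) - h Q - hi)
  <= c * \sum_(x in D) v x ^+ 2.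

Let G := side_perms U.

Definition side_average P : R := (\sum_(s in G) h (relabel s P)) / #|G|%:R.
Local Notation Phi := side_average.

Let cardG_gt0 : 0 < #|G|%:R :> R.
Proof. by rewrite ltr0n side_perms_gt0. Qed.

Let cardG_neq0 : #|G|%:R != 0 :> R.
Proof. by rewrite gt_eqF. Qed.

Lemma side_average_relabel s P : s \in G -> Phi (relabel s P) = Phi P.
Proof.
move=> sG; rewrite /Phi; congr (_ / _).
rewrite [RHS](reindex_inj (mulgI s)); apply: eq_big => [t|t _].
  by rewrite mem_side_permsM.
by rewrite relabelM.
Qed.

Let PhiD P k : Phi P + k = (\sum_(s in G) (h (relabel s P) + k)) / #|G|%:R.
Proof.
by rewrite big_split /= sumr_const mulrDl -[k *+ _]mulr_natr mulfK.
Qed.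

Lemma side_average_add_ge B P : B \notin P -> Phi P - c <= Phi (B |: P).
Proof.
move=> BP; rewrite PhiD ler_pM2r ?invr_gt0 //; apply: ler_sum => s _.
by rewrite relabelU1 h_add_ge // mem_relabel.
Qed.

Lemma side_average_add_le B P : B \notin P -> Phi (B |: P) <= Phi P + hi.
Proof.
move=> BP; rewrite PhiD ler_pM2r ?invr_gt0 //; apply: ler_sum => s _.
by rewrite relabelU1 h_add_le // mem_relabel.
Qed.

(** The condition is linear in [h]: for each [s] it is applied to the images of [Q], [A] and [D]
    under [s], with the vector [v] moved along, and the results are averaged. *)
Lemma side_average_negtype Q A D (v : T -> R) :
  (forall x, x \in D -> x \notin cover Q) ->
  \sum_(x in D) \sum_(y in D | y != x)
     v x * v y * (Phi ((x |: (y |: A)) |: Q) - Phi Q - hi)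
  <= c * \sum_(x in D) v x ^+ 2.
Proof.
move=> DQ.
pose F s x y := v x * v y * (h ((s x |: (s y |: s @: A)) |: relabel s Q) -
                             h (relabel s Q) - hi).
have -> : \sum_(x in D) \sum_(y in D | y != x)
     v x * v y * (Phi ((x |: (y |: A)) |: Q) - Phi Q - hi) =
   (\sum_(s in G) \sum_(x in D) \sum_(y in D | y != x) F s x y) / #|G|%:R.
  rewrite exchange_big mulr_suml; apply: eq_bigr => x _ /=.
  rewrite exchange_big mulr_suml; apply: eq_bigr => y _ /=.
  rewrite -mulr_sumr -[RHS]mulrA; congr (_ * _).
  rewrite !sumrB sumr_const -[hi *+ _]mulr_natr !mulrBl mulfK //.
  by congr (_ / _ - _ - _); apply: eq_bigr => s _; rewrite relabelU1 !imsetU1.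
rewrite ler_pdivrMr // mulr_natr -sumr_const; apply: ler_sum => s _.
have mD x : (s x \in s @: D) = (x \in D) by rewrite mem_imset //; apply: perm_inj.
have sDQ x : x \in s @: D -> x \notin cover (relabel s Q).
  move=> /imsetP[y yD ->]; rewrite cover_relabel mem_imset ?DQ //.
  exact: perm_inj.
have := @h_negtype (relabel s Q) (s @: A) (s @: D) (v \o (s^-1)%g) sDQ.
rewrite (reindex_inj (@perm_inj _ s)) (eq_bigl _ _ mD).
have -> : \sum_(x in s @: D) (v \o (s^-1)%g) x ^+ 2 = \sum_(x in D) v x ^+ 2.
  rewrite (reindex_inj (@perm_inj _ s)) (eq_bigl _ _ mD).
  by apply: eq_bigr => x _; rewrite /= permK.
apply: le_trans.
rewrite le_eqVlt; apply/orP; left; apply/eqP; apply: eq_bigr => x _.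
rewrite [RHS](reindex_inj (@perm_inj _ s)); apply: eq_big => [y|y _].
  by rewrite mD (inj_eq (@perm_inj _ s)).
by rewrite /F /= !permK.
Qed.

(** A side-preserving permutation carries [E] to [E'] and fixes all other points, in particular
    those covered by [Q]. *)
Lemma side_average_type Q E E' :
  (forall x, x \in E :|: E' -> x \notin cover Q) ->
  #|E| = #|E'| -> #|E :&: U| = #|E' :&: U| ->
  Phi (E |: Q) = Phi (E' |: Q).
Proof.
move=> dQ cE cEU; have [s sG [sE sfix]] := perm_same_type cE cEU.
rewrite -(side_average_relabel _ sG) relabelU1 sE relabel_fix // => x xQ.
by apply: sfix; apply: contraTN xQ => /dQ.
Qed.

(* Test vector of the negative-type inequality: the difference of the uniform
   distributions on the two sides of [D]. *)
Lemma side_average_step Q A D p p1 q q1 :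
  (forall x, x \in D -> x \notin cover Q) ->
  (forall x, x \in A -> x \notin cover Q) ->
  (forall x, x \in D -> x \notin A) ->
  p \in D -> p1 \in D -> p \in U -> p1 \in U -> p != p1 ->
  q \in D -> q1 \in D -> q \notin U -> q1 \notin U -> q != q1 ->
  Phi ((p |: (p1 |: A)) |: Q) + Phi ((q |: (q1 |: A)) |: Q)
    - c * (#|D :&: U|%:R^-1 + #|D :\: U|%:R^-1)
  <= 2 * Phi ((p |: (q |: A)) |: Q).
Proof.
move=> DQ AQ DA pD p1D pU p1U pp1 qD q1D qU q1U qq1.
set w1 : R := #|D :&: U|%:R; set w2 : R := #|D :\: U|%:R.
have w1_neq0 : w1 != 0 by rewrite pnatr_eq0 -lt0n; apply/card_gt0P; exists p; rewrite inE pD.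
have w2_neq0 : w2 != 0 by rewrite pnatr_eq0 -lt0n; apply/card_gt0P; exists q; rewrite inE qD qU.
have type x y x' y' : x \in D -> y \in D -> x' \in D -> y' \in D ->
    x != y -> x' != y' -> ((x \in U) + (y \in U) = (x' \in U) + (y' \in U))%N ->
    Phi ((x |: (y |: A)) |: Q) = Phi ((x' |: (y' |: A)) |: Q).
  move=> xD yD x'D y'D xy x'y' eU.
  have cU u w : u \in D -> w \in D -> u != w ->
      #|(u |: (w |: A)) :&: U| = ((u \in U) + (w \in U) + #|A :&: U|)%N.
    by move=> uD wD uw; rewrite card_setU2I ?DA.
  apply: side_average_type.
  - move=> z; rewrite !inE; have [zA _|zA] := boolP (z \in A); first exact: AQ.
    by rewrite !orbF => /orP[] /orP[] /eqP ->; apply: DQ.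
  - by rewrite !cardsU1 !inE !negb_or xy x'y' !DA.
  - by rewrite !cU // eU.
pose kap x y := Phi ((x |: (y |: A)) |: Q) - Phi Q - hi.
pose v x := if x \in U then w1^-1 else - w2^-1.
have nQ E x : x \in D -> x \in E -> E \notin Q.
  move=> /DQ xD xE; apply: contraNN xD => EQ; by apply/bigcupP; exists E.
(* A block gains at most [hi], so the same-side kernels are nonpositive. This sign allows the
   factors [1 - w1^-1] and [1 - w2^-1] to be replaced by 1 at the end. *)
have kap11 : kap p p1 <= 0.
  by rewrite /kap lerBlDr add0r lerBlDr addrC side_average_add_le // (nQ _ p) // !inE eqxx.
have kap22 : kap q q1 <= 0.
  by rewrite /kap lerBlDr add0r lerBlDr addrC side_average_add_le // (nQ _ q) // !inE eqxx.
have := @side_average_negtype Q A D v DQ.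
have cDU x : x \in D :&: U -> #|[pred y | [&& y \in D, y != x & y \in U]]|%:R = w1 - 1.
  move=> xDU; rewrite /w1 (cardsD1 x) xDU add1n -natr1 addrK; congr (_%:R).
  by apply: eq_card => y; rewrite !inE andbCA.
have cDU' x : x \in D :\: U -> #|[pred y | [&& y \in D, y != x & y \notin U]]|%:R = w2 - 1.
  move=> xDU; rewrite /w2 (cardsD1 x) xDU add1n -natr1 addrK; congr (_%:R).
  by apply: eq_card => y; rewrite !inE; do 3!case: (_ \in _) || case: eqP.
(* The kernel depends only on the sides of its arguments: [x] meets [w1 - 1] other points of its own
   side and [w2] points of the other side. *)
have sum1 x : x \in D :&: U ->
    \sum_(y in D | y != x) v x * v y * kap x y =
    (w1 - 1) * (w1^-1 ^+ 2 * kap p p1) - w1^-1 * kap p q.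
  move=> xDU; have := xDU; rewrite inE => /andP[xD xU].
  rewrite (bigID (mem U)) /=; congr (_ + _).
    rewrite -(cDU x xDU) mulr_natl -sumr_const; apply: eq_big => [y|y].
      by rewrite !inE andbA.
    move=> /andP[/andP[yD yx] yU]; rewrite /v xU yU /kap (type x y p p1) // 1?eq_sym //.
    by rewrite xU yU pU p1U.
  have -> : w1^-1 * kap p q = w2 * (w1^-1 * w2^-1 * kap p q) by field; rewrite ?w1_neq0 ?w2_neq0.
  rewrite mulr_natl -mulNrn -sumr_const; apply: eq_big => [y|y].
    rewrite !inE; case yU : (y \in U); rewrite /= ?andbF // andbT.
    by case: eqP => [yx|]; rewrite ?andbT // yx xU in yU *.
  move=> /andP[/andP[yD yx] yU]; rewrite /v xU (negPf yU) /kap (type x y p q) // 1?eq_sym //.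
  - by rewrite mulrN mulNr.
  - by apply: contraNneq qU => ->.
  - by rewrite xU (negPf yU) pU (negPf qU).
have sum2 x : x \in D :\: U ->
    \sum_(y in D | y != x) v x * v y * kap x y =
    (w2 - 1) * (w2^-1 ^+ 2 * kap q q1) - w2^-1 * kap p q.
  move=> xDU; have := xDU; rewrite inE => /andP[xU xD].
  rewrite (bigID (mem U)) /= addrC; congr (_ + _).
    rewrite -(cDU' x xDU) mulr_natl -sumr_const; apply: eq_big => [y|y].
      by rewrite !inE andbA.
    move=> /andP[/andP[yD yx] yU]; rewrite /v (negPf xU) (negPf yU) /kap (type x y q q1) // 1?eq_sym //.
      by rewrite expr2 mulrNN.
    by rewrite (negPf xU) (negPf yU) (negPf qU) (negPf q1U).
  have -> : w2^-1 * kap p q = w1 * (w1^-1 * w2^-1 * kap p q) by field; rewrite ?w1_neq0 ?w2_neq0.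
  rewrite mulr_natl -mulNrn -sumr_const; apply: eq_big => [y|y].
    rewrite !inE; case yU : (y \in U); rewrite /= ?andbF // andbT.
    by case: eqP => [yx|]; rewrite ?andbT // yx (negPf xU) in yU *.
  move=> /andP[/andP[yD yx] yU]; rewrite /v (negPf xU) yU /kap (type x y p q) // 1?eq_sym //.
  - by rewrite [- _ * _]mulrC mulrN mulNr.
  - by apply: contraNneq qU => ->.
  - by rewrite (negPf xU) yU pU (negPf qU).
rewrite (big_setID U) /= (eq_bigr _ sum1) (eq_bigr _ sum2) !sumr_const.
have -> : \sum_(x in D) v x ^+ 2 = w1^-1 + w2^-1.
  rewrite (big_setID U) /=; congr (_ + _).
    rewrite (eq_bigr (fun _ => w1^-1 ^+ 2)) => [|x]; last by rewrite /v inE => /andP[_ ->].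
    by rewrite sumr_const -mulr_natr -/w1; field.
  rewrite (eq_bigr (fun _ => w2^-1 ^+ 2)) => [|x]; last by rewrite /v inE => /andP[/negPf -> _]; rewrite sqrrN.
  by rewrite sumr_const -mulr_natr -/w2; field.
rewrite -[X in X + _ <= _]mulr_natr -[X in _ + X <= _]mulr_natr -/w1 -/w2 => main.
have {}main : (1 - w1^-1) * kap p p1 + (1 - w2^-1) * kap q q1 - 2 * kap p q
    <= c * (w1^-1 + w2^-1).
  apply: le_trans main; rewrite le_eqVlt; apply/orP; left; apply/eqP; field.
  by rewrite ?w1_neq0 ?w2_neq0.
have k1 : 0 <= - (w1^-1 * kap p p1).
  by rewrite -mulrN mulr_ge0 ?oppr_ge0 // invr_ge0 ler0n.
have k2 : 0 <= - (w2^-1 * kap q q1).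
  by rewrite -mulrN mulr_ge0 ?oppr_ge0 // invr_ge0 ler0n.
move: main k1 k2; rewrite !mulrBl !mul1r /kap; lra.
Qed.

End SymmetrizedFunctional.

(** * Families of disjoint blocks *)

Section BlockFamilies.
Variables (T : finType) (U : {set T}) (K : nat).
Hypothesis K_gt0 : (0 < K)%N.
Implicit Types (s : {perm T}) (A B D E : {set T}) (P Q : {set {set T}}).

Definition block_family P := trivIset P && [forall B in P, #|B| == K].

Definition internal P := [forall B in P, (B \subset U) || (B \subset ~: U)].

Lemma block_familyP P :
  reflect ([/\ forall B, B \in P -> #|B| = K &
    forall B C x, B \in P -> C \in P -> x \in B -> x \in C -> B = C])
    (block_family P).
Proof.
apply: (iffP andP) => [[/trivIsetP tP /forall_inP cP]|[cP dP]]; split.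
- by move=> B /cP/eqP.
- move=> B C x BP CP xB xC; apply/eqP; apply: contraTT isT => BC.
  by have /disjointFr/(_ xB) := tP _ _ BP CP BC; rewrite xC.
- apply/trivIsetP => B C BP CP; apply: contraNT => /pred0Pn[x /andP[xB xC]].
  by apply/eqP/(dP _ _ x).
- by apply/forall_inP => B /cP/eqP.
Qed.

Lemma block_family_sub P Q : P \subset Q -> block_family Q -> block_family P.
Proof.
move=> /subsetP sPQ /block_familyP[cQ dQ]; apply/block_familyP.
split=> [B /sPQ|B C x /sPQ + /sPQ]; [exact: cQ | exact: dQ].
Qed.

Lemma card_cover_family P : block_family P -> #|cover P| = (#|P| * K)%N.
Proof.
move=> /andP[tP /forall_inP cP]; rewrite -sum_nat_const; move/eqP: tP => <-.
by apply: eq_bigr => B /cP/eqP.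
Qed.

Lemma card_full_family P : block_family P -> cover P = [set: T] -> (#|P| * K)%N = #|T|.
Proof. by move=> /card_cover_family <- ->; rewrite cardsT. Qed.

Lemma card_family_le P : block_family P -> (#|P| <= #|T|)%N.
Proof.
move=> fP; apply: (@leq_trans (#|P| * K)%N); first by rewrite leq_pmulr.
by rewrite -card_cover_family // max_card.
Qed.

Lemma relabel_family s P : block_family (relabel s P) = block_family P.
Proof.
have inj := @perm_inj _ s.
apply/block_familyP/block_familyP => -[cP dP]; split.
- by move=> B BP; rewrite -(card_imset _ inj) cP // mem_relabel.
- move=> B C x BP CP xB xC; apply: (@imset_perm_inj _ s).
  by apply: (dP _ _ (s x)); rewrite ?mem_relabel ?imset_f.
- by move=> _ /imsetP[B BP ->]; rewrite card_imset // cP.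
- move=> _ _ _ /imsetP[B BP ->] /imsetP[C CP ->] /imsetP[x xB ->].
  by rewrite mem_imset // => xC; rewrite (dP B C x).
Qed.

Lemma relabel_internal s P : s \in side_perms U -> internal P -> internal (relabel s P).
Proof.
move=> /side_permsP sU /forall_inP iP; apply/forall_inP => _ /imsetP[B BP ->].
by case/orP: (iP _ BP) => /subsetP sB; apply/orP; [left|right];
  apply/subsetP => _ /imsetP[x /sB xU ->]; move: xU; rewrite ?inE sU.
Qed.

(* The side [V] containing [B] is covered by blocks of the full internal family, so it
   holds at least as many of them as of blocks of [P]. *)
Lemma exists_free_target P P' B :
  block_family P -> internal P -> block_family P' -> internal P' ->
  cover P' = [set: T] -> B \in P -> B \notin P' ->
  exists2 B', B' \in P' & (B' \notin P) && (#|B' :&: U| == #|B :&: U|).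
Proof.
move=> fP /forall_inP iP fP' /forall_inP iP' cP' BP BP'.
have [cP _] := block_familyP _ fP; have [cP'K _] := block_familyP _ fP'.
have key V : (V = U) \/ (V = ~: U) -> B \subset V ->
    exists2 B', B' \in P' & (B' \notin P) && (B' \subset V).
  move=> hV BV.
  pose side (X : {set {set T}}) := [set C in X | C \subset V].
  have sub X : side X \subset X by apply/subsetP => C; rewrite inE => /andP[].
  have cV' : cover (side P') = V.
    apply/setP => x; apply/bigcupP/idP => [[C]|xV].
      by rewrite inE => /andP[_ /subsetP]; apply.
    have /bigcupP[C CP' xC] : x \in cover P' by rewrite cP' inE.
    exists C => //; rewrite inE CP'; move: xV.
    case: hV => ->; case/orP: (iP' _ CP') => // /subsetP/(_ _ xC) + xV.
      by rewrite inE xV.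
    by move: xV; rewrite inE => /negPf ->.
  have cVP : cover (side P) \subset V.
    by apply/bigcupsP => C; rewrite inE => /andP[].
  have le : (#|side P| <= #|side P'|)%N.
    rewrite -(leq_pmul2r K_gt0) -!card_cover_family ?cV' ?subset_leq_card //.
      exact: block_family_sub (sub _) fP'.
    exact: block_family_sub (sub _) fP.
  have /subsetPn[B' ] : ~~ (side P' \subset side P).
    apply: contra BP' => sP; have /eqP eP : side P' == side P by rewrite eqEcard sP.
    by apply: (subsetP (sub P')); rewrite eP inE BP.
  rewrite !inE => /andP[B'P' B'V]; rewrite B'V andbT => B'P.
  by exists B' => //; rewrite B'P.
(* A block contained in one side meets [U] in all its [K] points or in none. *)
have cU C V : C \in P \/ C \in P' -> (V = U) \/ (V = ~: U) -> C \subset V ->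
    #|C :&: U| = if V == U then K else 0%N.
  move=> hC hV sC; have cC : #|C| = K by case: hC => [/cP|/cP'K].
  case: hV => hV; subst V; first by rewrite eqxx; move/setIidPl: sC => ->.
  have -> : C :&: U = set0.
    by apply/eqP; rewrite setI_eq0 -[U]setCK disjoints_subset setCK.
  rewrite cards0; case: eqP => // eU.
  suff /eqP : C = set0 by rewrite -cards_eq0 cC => /eqP.
  apply/setP => x; rewrite [in RHS]inE; apply/negP => /(subsetP sC) xU.
  by move: (xU); rewrite inE -[in ~~ _]eU xU.
have [V hV BV] : exists2 V, V = U \/ V = ~: U & B \subset V.
  by case/orP: (iP _ BP) => sB; [exists U => //; left | exists (~: U) => //; right].
have [B' B'P' /andP[B'P B'V]] := key V hV BV.
exists B' => //; rewrite B'P; apply/eqP.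
by rewrite (cU B' V) ?(cU B V); auto.
Qed.

Lemma family_add Q E : block_family Q -> (forall x, x \in E -> x \notin cover Q) ->
  #|E| = K -> E \notin Q /\ block_family (E |: Q).
Proof.
move=> /block_familyP[cQ dQ] EQ cE.
have nC C x : C \in Q -> x \in C -> x \in E -> False.
  by move=> CQ xC /EQ/negP; apply; apply/bigcupP; exists C.
have E0 : exists x, x \in E by apply/card_gt0P; rewrite cE.
split; first by case: E0 => x xE; apply/negP => EinQ; apply: (nC E x).
apply/block_familyP; split=> [B|B C x]; rewrite !inE.
  by case/orP => [/eqP ->|/cQ].
case/orP => [/eqP ->|BQ] /orP[/eqP ->|CQ] // xB xC; try by case: (nC _ _ _ xC xB).
  by case: (nC _ _ BQ xB xC).
exact: dQ xC.
Qed.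

Lemma exists_block_family D : (K %| #|D|)%N -> exists2 P, block_family P & cover P = D.
Proof.
have [k] := ubnP #|D|; elim: k D => // k IH D leD KD.
have [->|D0] := eqVneq D set0.
  exists set0; last by rewrite /cover big_set0.
  by apply/block_familyP; split=> [B|B C x]; rewrite inE.
have leKD : (K <= #|D|)%N by rewrite dvdn_leq // card_gt0.
pose B := [set x in take K (enum D)].
have BD : B \subset D by apply/subsetP => x; rewrite inE => /mem_take; rewrite mem_enum.
have cB : #|B| = K.
  rewrite cardsE; have /card_uniqP -> := take_uniq K (enum_uniq D).
  by rewrite size_takel // -cardE.
have cDB : #|D :\: B| = (#|D| - K)%N by rewrite cardsD (setIidPr BD) cB.
have [||P fP cP] := IH (D :\: B); first by rewrite cDB; clear -leD leKD K_gt0; lia.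
  by rewrite cDB dvdn_sub.
have BcP x : x \in B -> x \notin cover P by move=> xB; rewrite cP inE xB.
have [BP fBP] := family_add fP BcP cB.
exists (B |: P) => //; rewrite /cover bigcup_setU big_set1 -/(cover P) cP.
apply/setP => x; rewrite in_setU in_setD.
by have [/(subsetP BD) ->|] := boolP (x \in B).
Qed.

End BlockFamilies.

(** * The interpolation *)

Section Interpolation.
Variables (R : realFieldType) (T : finType) (U : {set T}) (K : nat).
Variables (Phi : {set {set T}} -> R) (c : R).
Implicit Types (s : {perm T}) (A B D E V : {set T}) (P Q : {set {set T}}).

Hypothesis K_gt0 : (0 < K)%N.
Hypothesis c_gt0 : 0 < c.
Hypothesis Phi_add_ge : forall B P, B \notin P -> Phi P - c <= Phi (B |: P).
Hypothesis Phi_add_le : forall B P, B \notin P -> Phi (B |: P) <= Phi P + c.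
Hypothesis Phi_relabel : forall s P, s \in side_perms U -> Phi (relabel s P) = Phi P.
Hypothesis Phi_step : forall Q A D p p1 q q1,
  (forall x, x \in D -> x \notin cover Q) ->
  (forall x, x \in A -> x \notin cover Q) ->
  (forall x, x \in D -> x \notin A) ->
  p \in D -> p1 \in D -> p \in U -> p1 \in U -> p != p1 ->
  q \in D -> q1 \in D -> q \notin U -> q1 \notin U -> q != q1 ->
  Phi ((p |: (p1 |: A)) |: Q) + Phi ((q |: (q1 |: A)) |: Q)
    - c * (#|D :&: U|%:R^-1 + #|D :\: U|%:R^-1)
  <= 2 * Phi ((p |: (q |: A)) |: Q).

Local Notation n := #|T|.
Local Notation family := (block_family K).

Lemma Phi_sub P P' : P \subset P' ->
  Phi P' - c * (#|P'|%:R - #|P|%:R) <= Phi P /\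
  Phi P - c * (#|P'|%:R - #|P|%:R) <= Phi P'.
Proof.
have [k] := ubnP #|P' :\: P|; elim: k P => // k IH P lek sP.
have [sP'|/subsetPn[B BP' BP]] := boolP (P' \subset P).
  have -> : P = P' by apply/eqP; rewrite eqEsubset sP.
  by rewrite subrr mulr0 subr0.
have sBP : B |: P \subset P' by apply/subsetP => C; rewrite !inE => /orP[/eqP -> //|/(subsetP sP)].
have [||h1 h2] := IH (B |: P); last 1 first.
- have := Phi_add_ge BP; have := Phi_add_le BP.
  by move: h1 h2; rewrite cardsU1 BP natrD /= !mulrBr mulrDr mulr1; split; lra.
- rewrite -ltnS (leq_trans _ lek) // ltnS; apply: proper_card; apply/properP; split.
    by apply/subsetP => C; rewrite !inE negb_or => /andP[/andP[_ ->]].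
  by exists B; rewrite !inE ?BP ?BP' ?eqxx.
- exact: sBP.
Qed.

(** Both families are compared with the empty one, at a cost of [c] for each of at most [n] blocks.
    This crude bound serves where [occupied] has drifted far. *)
Lemma Phi_family_ge P P' : family P -> family P' -> Phi P' - 2 * c * n%:R <= Phi P.
Proof.
move=> fP fP'.
have [[h1 h2] [h3 h4]] := (Phi_sub (sub0set P), Phi_sub (sub0set P')).
have leP : c * #|P|%:R <= c * n%:R by rewrite ler_pM2l // ler_nat (card_family_le K_gt0).
have leP' : c * #|P'|%:R <= c * n%:R by rewrite ler_pM2l // ler_nat (card_family_le K_gt0).
by move: h1 h2 h3 h4; rewrite cards0 !subr0; lra.
Qed.

Lemma Phi_internal_ge P P' :
  family P -> internal U P -> family P' -> internal U P' -> cover P' = [set: T] ->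
  Phi P' - c * (#|P'|%:R - #|P|%:R) <= Phi P.
Proof.
move=> + + fP' iP' cP'.
have [k] := ubnP #|P :\: P'|; elim: k P => // k IH P lek fP iP.
have [sP|/subsetPn[B BP BP']] := boolP (P \subset P').
  exact: (Phi_sub sP).1.
have [B' B'P' /andP[B'P /eqP cU]] := exists_free_target K_gt0 fP iP fP' iP' cP' BP BP'.
have [cP dP] := block_familyP _ _ fP; have [cP'K dP'] := block_familyP _ _ fP'.
have [|s sG [sB sfix]] := @perm_same_type _ U B B' _ (esym cU); first by rewrite cP ?cP'K.
rewrite -(Phi_relabel P sG) -(card_relabel s P); apply: IH; last first.
- exact: relabel_internal.
- by rewrite relabel_family.
rewrite -ltnS (leq_trans _ lek) // ltnS -(card_relabel s (P :\: P')).
(* A block common to [P] and [P'] is disjoint from [B] inside [P] and from [B'] inside [P'], hence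
   fixed by [s]; and [B] itself now lands in [P']. *)
apply: proper_card; apply/properP; split.
  apply/subsetP => _ /setDP[/imsetP[C CP ->] sC]; rewrite mem_relabel inE CP andbT.
  apply: contra sC => CP'; rewrite imset_fix // => x xC; apply: sfix.
  rewrite !inE negb_or; apply/andP; split.
    by apply: contra BP' => xB; rewrite (dP B C x).
  by apply: contra B'P => xB; rewrite (dP' B' C x).
exists (s @: B); first by rewrite mem_relabel inE BP BP'.
by rewrite inE sB B'P'.
Qed.

Definition occupied P : nat := \sum_(B in P) #|B :&: U|.
(** Counts the pairs of points of one block on opposite sides. With [a], [b] points of the remaining
    block on the two sides, [(a+2)*b + a*(b+2) = 2*(a+1)*(b+1) - 2], so the mean drop in a step is
    exactly 1. *)
Definition crossing P : nat := \sum_(B in P) #|B :&: U| * #|B :\: U|.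

Lemma crossing_le P : family P -> (crossing P <= K * n)%N.
Proof.
move=> fP; have [cP _] := block_familyP _ _ fP.
apply: (@leq_trans (K * (#|P| * K))%N); last first.
  by rewrite leq_mul2l -card_cover_family // max_card orbT.
rewrite mulnA -mulnAC mulnC -sum_nat_const; apply: leq_sum => B BP.
by rewrite -(cP B BP) leq_mul // subset_leq_card ?subsetIl ?subsetDl.
Qed.

Lemma card_freeI P V : family P ->
  (#|V :\: cover P| + \sum_(B in P) #|B :&: V| = #|V|)%N.
Proof.
move=> /andP[tP _].
rewrite addnC -(cardsID (cover P) V); congr (_ + _)%N.
transitivity #|cover P :&: V|; last by rewrite setIC.
rewrite -sum1_card (partition_big (pblock P) (mem P)) => [|x]; last first.
  by rewrite inE => /andP[xP _]; rewrite /= pblock_mem.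
apply: eq_bigr => B BP; rewrite -sum1_card; apply: eq_bigl => x.
rewrite !inE; apply/andP/andP => [[xB xV]|[/andP[xP xV] /eqP <-]].
  by rewrite xV (def_pblock tP BP xB) eqxx andbT; split=> //; apply/bigcupP; exists B.
by rewrite mem_pblock.
Qed.

Let crossing_add Q E : E \notin Q ->
  crossing (E |: Q) = (#|E :&: U| * #|E :\: U| + crossing Q)%N.
Proof. exact: big_setU1. Qed.

Let occupied_add Q E : E \notin Q -> occupied (E |: Q) = (#|E :&: U| + occupied Q)%N.
Proof. exact: big_setU1. Qed.

(* Replacing the crossing block by one of its two neighbours with equal probability lowers
   the mean of [crossing] by 1 and raises that of the squared deviation of [occupied] by
   1, so the penalised functional has no minimum at a family with a crossing block and
   many free points; its minimum is therefore reached at an internal family or at one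
   where [occupied] deviates by at least [m/2]. *)
Lemma interpolation_bound (m : nat) (L : R) P0 :
  (0 < m)%N -> family P0 ->
  (m <= #|U :\: cover P0|)%N -> (m <= #|~: U :\: cover P0|)%N ->
  (forall P, family P -> internal U P -> #|P| = #|P0| -> L <= Phi P) ->
  (forall P, family P -> #|P| = #|P0| -> L - 2 * c * n%:R <= Phi P) ->
  L - (3 * c / m%:R + 8 * c * n%:R / m%:R ^+ 2) * (crossing P0)%:R <= Phi P0.
Proof.
move=> m_gt0 fP0 free1 free2 hint hall.
have mR : 0 < m%:R :> R by rewrite ltr0n.
(* [2 * alpha] must strictly exceed the step error [4 * c / m], which comes from at least [m/2] free
   points on each side; [gamma * (m/2)^2] equals the crude loss [2 * c * n]. *)
set alpha := 3 * c / m%:R; set gamma := 8 * c * n%:R / m%:R ^+ 2.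
have alpha_ge0 : 0 <= alpha by rewrite !mulr_ge0 ?invr_ge0 ?ler0n ?(ltW c_gt0).
have gamma_ge0 : 0 <= gamma.
  by rewrite !mulr_ge0 ?invr_ge0 ?exprn_ge0 ?ler0n ?(ltW c_gt0).
pose g P := Phi P + alpha * (crossing P)%:R +
  gamma * (((occupied P)%:R - (occupied P0)%:R) ^+ 2 + (crossing P)%:R).
pose state P := family P && (#|P| == #|P0|).
have state0 : state P0 by rewrite /state fP0 eqxx.
suff : exists2 P, state P & L <= g P /\ g P <= g P0.
  case=> P _ [h1 h2]; have := le_trans h1 h2.
  by rewrite /g subrr expr0n add0r mulrDl; lra.
have [P /andP[fP /eqP cardP] minP] := @arg_minP _ R _ P0 state g state0.
have gP0 := minP _ state0.
have sP : state P by rewrite /state fP cardP eqxx.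
exists P => //; split => //.
have cr_ge0 : 0 <= (crossing P)%:R :> R by rewrite ler0n.
have sq_ge0 := sqr_ge0 ((occupied P)%:R - (occupied P0)%:R : R).
have [iP|] := boolP (internal U P).
  have := hint P fP iP cardP; rewrite /g.
  have := mulr_ge0 alpha_ge0 cr_ge0; have := mulr_ge0 gamma_ge0 (addr_ge0 sq_ge0 cr_ge0).
  lra.
have occ1 := card_freeI U fP; have occ1_0 := card_freeI U fP0.
have occ2 := card_freeI (~: U) fP; have occ2_0 := card_freeI (~: U) fP0.
rewrite -/(occupied P) in occ1; rewrite -/(occupied P0) in occ1_0.
have occK X : family X -> (occupied X + \sum_(B in X) #|B :&: ~: U| = #|X| * K)%N.
  move=> fX; rewrite /occupied -big_split /= -sum_nat_const.
  have [cX _] := block_familyP _ _ fX; apply: eq_bigr => B BX.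
  by rewrite -setDE cardsID cX.
have eocc := occK _ fP; have eocc0 := occK _ fP0; rewrite cardP in eocc.
have [large|] := boolP ((m <= 2 * #|U :\: cover P|) && (m <= 2 * #|~: U :\: cover P|))%N; last first.
  move=> small _; have := hall P fP cardP; rewrite /g.
  have dev : m%:R ^+ 2 / 4 <= ((occupied P)%:R - (occupied P0)%:R) ^+ 2 :> R.
    have quarter : m%:R ^+ 2 / 4 = (m%:R / 2) ^+ 2 :> R by field.
    (* One side has gone from at least [m] free points to fewer than [m/2]. The total number of
       occupied points is fixed by the number of blocks, so a change on either side shows in
       [occupied]. *)
    have hdev : (m + 2 * occupied P0 <= 2 * occupied P)%N \/ (m + 2 * occupied P <= 2 * occupied P0)%N.
      by clear -small free1 free2 occ1 occ1_0 occ2 occ2_0 eocc eocc0; lia.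
    have [] := hdev; rewrite -(ler_nat R) natrD !natrM => h.
      have : (m%:R / 2) ^+ 2 <= ((occupied P)%:R - (occupied P0)%:R) ^+ 2 :> R.
        by rewrite ler_sqr ?nnegrE; lra.
      by rewrite quarter.
    have : (m%:R / 2) ^+ 2 <= ((occupied P0)%:R - (occupied P)%:R) ^+ 2 :> R.
      by rewrite ler_sqr ?nnegrE; lra.
    by rewrite quarter -[in X in _ -> X]opprB sqrrN.
  have : gamma * (m%:R ^+ 2 / 4) <=
      gamma * (((occupied P)%:R - (occupied P0)%:R) ^+ 2 + (crossing P)%:R).
    by rewrite ler_wpM2l //; lra.
  have -> : gamma * (m%:R ^+ 2 / 4) = 2 * c * n%:R.
    by rewrite /gamma; field; rewrite gt_eqF.
  have := mulr_ge0 alpha_ge0 cr_ge0; lra.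
move=> /forall_inPn[B BP]; rewrite negb_or => /andP[/subsetPn[q qB qU] /subsetPn[p pB]].
rewrite inE negbK => pU; exfalso.
have pq : p != q by apply: contraNneq qU => <-.
have [cP dP] := block_familyP _ _ fP.
move: large => /andP[large1 large2].
have /card_gt0P[p1 p1F] : (0 < #|U :\: cover P|)%N by clear -m_gt0 large1; lia.
have /card_gt0P[q1 q1F] : (0 < #|~: U :\: cover P|)%N by clear -m_gt0 large2; lia.
move: p1F q1F; rewrite !inE => /andP[p1P p1U] /andP[q1P q1U].
(* Once [B] is removed and [A] is kept aside, [D] holds [p], [q] and all free points of [P], so both
   sides of [D] have at least [m/2] points. *)
pose Q := P :\ B; pose A := B :\ p :\ q; pose D := ~: cover Q :\: A.
have QP : P = B |: Q by rewrite setD1K.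
have fQ : family Q by apply: block_family_sub fP; apply: subD1set.
have QcP x : x \notin cover P -> x \notin cover Q.
  apply: contra => /bigcupP[C]; rewrite inE => /andP[_ CP] xC; by apply/bigcupP; exists C.
have BQ x : x \in B -> x \notin cover Q.
  move=> xB; apply/bigcupP => -[C]; rewrite !inE => /andP[/eqP CB CP] xC.
  by apply: CB; apply: (dP _ _ x).
have BcP x : x \in B -> x \in cover P by move=> xB; apply/bigcupP; exists B.
have AB x : x \in A -> x \in B by rewrite !inE => /and3P[].
have FA x : x \notin cover P -> x \notin A by apply: contra => /AB/BcP.
have pA : p \notin A by rewrite !inE eqxx andbF.
have qA : q \notin A by rewrite !inE eqxx.
have FB x : x \notin cover P -> x \notin B by apply: contra => /BcP.
have pp1 : p != p1 by apply: contraNneq (FB _ p1P) => <-.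
have qq1 : q != q1 by apply: contraNneq (FB _ q1P) => <-.
have BE : B = p |: (q |: A).
  by apply/setP => x; rewrite !inE; case: (eqVneq x p) => [->//|_]; case: (eqVneq x q) => [->|].
have DE x : x \in D = (x \notin A) && (x \notin cover Q) by rewrite !inE.
have nB : B \notin Q by rewrite !inE eqxx.
clearbody D A Q.
have cardQ : #|P| = #|Q|.+1 by rewrite QP cardsU1 nB.
have inD x : x \in D -> x \notin cover Q by rewrite DE => /andP[].
have inDA x : x \in D -> x \notin A by rewrite DE => /andP[].
have pD : p \in D by rewrite DE pA BQ.
have qD : q \in D by rewrite DE qA BQ.
have p1D : p1 \in D by rewrite DE FA // QcP.
have q1D : q1 \in D by rewrite DE FA // QcP.
have step := Phi_step inD (fun x xA => BQ x (AB x xA)) inDA pD p1D pU p1U pp1 qD q1D qU q1U qq1.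
rewrite -BE -QP in step.
have cpq V := card_setU2I V pq pA qA.
have cpp V := card_setU2I V pp1 pA (FA _ p1P).
have cqq V := card_setU2I V qq1 qA (FA _ q1P).
have cA : (#|A| + 2 = K)%N.
  by rewrite -(cP _ BP) BE !cardsU1 in_setU1 (negPf pq) (negPf pA) qA /= !add1n addn2.
have newE x y : x \notin A -> y \notin A -> x != y -> x \notin cover Q -> y \notin cover Q ->
    [/\ x |: (y |: A) \notin Q & state ((x |: (y |: A)) |: Q)].
  move=> xA yA xy xQ yQ; have [||nE fE] := family_add K_gt0 (E := x |: (y |: A)) fQ.
  - by move=> z; rewrite !in_setU1 => /or3P[/eqP ->|/eqP ->|/AB/BQ].
  - by rewrite !cardsU1 in_setU1 negb_or xy xA yA -cA /= !add1n addn2.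
  by split=> //; rewrite /state fE cardsU1 nE -cardP cardQ /= add1n eqxx.
have [nE1 s1] := newE p p1 pA (FA _ p1P) pp1 (BQ _ pB) (QcP _ p1P).
have [nE2 s2] := newE q q1 qA (FA _ q1P) qq1 (BQ _ qB) (QcP _ q1P).
have g1 := minP _ s1; have g2 := minP _ s2.
have [oP o1 o2] : [/\ occupied P = (1 + #|A :&: U| + occupied Q)%N,
    occupied ((p |: (p1 |: A)) |: Q) = (2 + #|A :&: U| + occupied Q)%N &
    occupied ((q |: (q1 |: A)) |: Q) = (#|A :&: U| + occupied Q)%N].
  rewrite [in occupied P]QP !occupied_add // BE cpq cpp cqq pU p1U (negPf qU) (negPf q1U).
  by rewrite !addn0 !add0n.
have crs : (crossing ((p |: (p1 |: A)) |: Q) + crossing ((q |: (q1 |: A)) |: Q) + 2 =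
    2 * crossing P)%N.
  rewrite [in crossing P]QP !crossing_add // BE !setDE !cpq !cpp !cqq !inE.
  rewrite pU p1U (negPf qU) (negPf q1U) /=; clear; nia.
have inv_lt V x : x \in D -> x \in V -> x \notin ~: cover P -> (m <= 2 * #|V :\: cover P|)%N ->
    #|D :&: V|%:R^-1 <= 2 / m%:R :> R.
  move=> xD xV xP large; have sub : V :\: cover P \subset D :&: V.
    by apply/subsetP => y; rewrite inE => /andP[yP yV]; rewrite inE DE yV FA ?QcP.
  have := subset_leq_card sub => le.
  have le2 : (m <= 2 * #|D :&: V|)%N by clear -large le; lia.
  have le3 : m%:R <= 2 * #|D :&: V|%:R :> R by rewrite -natrM ler_nat.
  have w0 : 0 < #|D :&: V|%:R :> R by lra.
  by rewrite -[X in X <= _]mul1r ler_pdivrMr // mulrAC ler_pdivlMr // mul1r.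
have i1 := inv_lt U p _ pU _ large1; have i2 := inv_lt (~: U) q _ _ _ large2.
rewrite -setDE in i2.
have {}i1 : #|D :&: U|%:R^-1 <= 2 / m%:R :> R.
  by apply: i1; rewrite ?DE ?pA ?BQ // inE negbK BcP.
have {}i2 : #|D :\: U|%:R^-1 <= 2 / m%:R :> R.
  by apply: i2; rewrite ?DE ?qA ?BQ ?inE ?negbK ?BcP.
have ci : c * (#|D :&: U|%:R^-1 + #|D :\: U|%:R^-1) <= c * (4 / m%:R).
  by rewrite ler_pM2l //; lra.
have c_m : 0 < c / m%:R by rewrite divr_gt0.
have ea : alpha = 3 * (c / m%:R) by rewrite /alpha mulrA.
have ec : c * (4 / m%:R) = 4 * (c / m%:R) by rewrite mulrCA.
have crsR : (crossing ((p |: (p1 |: A)) |: Q))%:R =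
    2 * (crossing P)%:R - 2 - (crossing ((q |: (q1 |: A)) |: Q))%:R :> R.
  by rewrite -natrM -crs !natrD; ring.
move: g1 g2; rewrite /g oP o1 o2 crsR !natrD => g1 g2.
(* In the sum of the two minimality inequalities the [gamma] terms cancel, since
   [(d+1)^2 + (d-1)^2 = 2*d^2 + 2] offsets the drop of [crossing]. What remains bounds [2 * alpha]
   by the step error, a contradiction. *)
suff : 2 * alpha <= c * (4 / m%:R) by rewrite ea ec; lra.
move: (c * (4 / _)) (c * (_ + _)) (alpha) (gamma) ((crossing P)%:R : R)
  ((crossing (_ |: _))%:R : R) ((occupied Q)%:R : R)
  ((occupied P0)%:R : R) (#|A :&: U|%:R : R) ci step g1 g2.
move=> ci4 k al ga x y o o0 a {}ci step g1 g2.
lra.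
Qed.

(** Deleting the blocks that meet [m] chosen points of each side costs at most [2 * c * m]. Internal
    families with that many fewer blocks are within another [2 * c * m] of [P'], and the
    interpolation supplies the other two terms. *)
Lemma Phi_full_ge (m : nat) P P' :
  (0 < m)%N -> family P -> cover P = [set: T] ->
  family P' -> internal U P' -> cover P' = [set: T] ->
  Phi P' - c * (4 * m%:R + 3 * (K * n)%:R / m%:R + 8 * K%:R * n%:R ^+ 2 / m%:R ^+ 2)
  <= Phi P.
Proof.
move=> m_gt0 fP coverP fP' iP' coverP'.
have mR : 0 < m%:R :> R by rewrite ltr0n.
have pick_sub (V : {set T}) : exists2 X : {set T}, X \subset V & #|X| = minn m #|V|.
  exists [set x in take m (enum V)].
    by apply/subsetP => x; rewrite inE => /mem_take; rewrite mem_enum.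
  rewrite cardsE; have /card_uniqP -> := take_uniq m (enum_uniq V).
  by rewrite size_take_min -cardE.
have [X1 sX1 cX1] := pick_sub U; have [X2 sX2 cX2] := pick_sub (~: U).
pose P0 := [set B in P | [disjoint B & X1 :|: X2]].
have sP0 : P0 \subset P by apply/subsetP => B; rewrite inE => /andP[].
have fP0 : family P0 := block_family_sub sP0 fP.
have X_free x : x \in X1 :|: X2 -> x \notin cover P0.
  move=> xX; apply/bigcupP => -[B]; rewrite inE => /andP[_ dB] xB.
  by rewrite (disjointFr dB xB) in xX.
have removed : (#|P| <= #|P0| + 2 * m)%N.
  rewrite -(cardsID P0 P) (setIidPr sP0) leq_add2l.
  have sub : P :\: P0 \subset [set pblock P x | x in X1 :|: X2].
    apply/subsetP => B; rewrite !inE => /andP[+ BP]; rewrite BP /= => /pred0Pn[x /andP[xB xX]].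
    apply/imsetP; exists x => //; apply/esym/def_pblock => //.
    by case/andP: fP.
  apply: leq_trans (subset_leq_card sub) _; apply: leq_trans (leq_imset_card _ _) _.
  by have := cardsUI X1 X2; clear -cX1 cX2; lia.
have cPP' : #|P| = #|P'|.
  by apply/eqP; rewrite -(eqn_pmul2r K_gt0) !card_full_family.
have removedR : c * (#|P|%:R - #|P0|%:R) <= 2 * c * m%:R.
  by rewrite -mulrA mulrCA ler_pM2l // lerBlDl -natrM -natrD ler_nat.
have {}drop : Phi P0 - 2 * c * m%:R <= Phi P.
  by have [_ drop] := Phi_sub sP0; move: drop removedR; lra.
have tail_ge0 : 0 <= c * (3 * (K * n)%:R / m%:R + 8 * K%:R * n%:R ^+ 2 / m%:R ^+ 2).
  by rewrite mulr_ge0 ?(ltW c_gt0) // addr_ge0 // !mulr_ge0 ?invr_ge0 ?exprn_ge0 ?ler0n.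
have goal_of L : L <= Phi P0 -> Phi P' - 2 * c * m%:R - c * (3 * (K * n)%:R / m%:R +
    8 * K%:R * n%:R ^+ 2 / m%:R ^+ 2) <= L ->
    Phi P' - c * (4 * m%:R + 3 * (K * n)%:R / m%:R + 8 * K%:R * n%:R ^+ 2 / m%:R ^+ 2)
    <= Phi P.
  by move=> h1 h2; move: drop tail_ge0 h1 h2; rewrite !mulrDr; lra.
have removedR' (X : {set {set T}}) : #|X| = #|P0| -> c * (#|P'|%:R - #|X|%:R) <= 2 * c * m%:R.
  by move=> ->; rewrite -cPP'.
have [iP0|niP0] := boolP (internal U P0).
  apply: goal_of (Phi_internal_ge fP0 iP0 fP' iP' coverP') _.
  by have := removedR' P0 erefl; move: tail_ge0; lra.
(* A side with at most [m] points would be freed entirely; the remaining blocks would then all lie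
   on the other side, and [P0] would be internal. *)
have big (V X : {set T}) : X \subset V -> #|X| = minn m #|V| -> X \subset X1 :|: X2 ->
    V = U \/ V = ~: U -> (m <= #|V :\: cover P0|)%N.
  move=> sX cX sXX hV; have [leV|ltV] := leqP #|V| m; last first.
    have <- : #|X| = m by rewrite cX; apply/minn_idPl/ltnW.
    apply: subset_leq_card; apply/subsetP => x xX.
    by rewrite inE X_free ?(subsetP sX) // (subsetP sXX).
  have eX : X = V by apply/eqP; rewrite eqEcard sX cX (minn_idPr leV) leqnn.
  case/negP: niP0; apply/forall_inP => B; rewrite inE => /andP[_ dB].
  have : [disjoint B & V].
    by apply: disjointWr dB; rewrite -eX.
  by case: hV => ->; rewrite disjoints_subset ?setCK => ->; rewrite ?orbT.
apply: goal_of (interpolation_bound (L := Phi P' - 2 * c * m%:R) m_gt0 fP0 _ _ _ _) _.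
- by apply: (big _ X1) => //; [apply: subsetUl | left].
- by apply: (big _ X2) => //; [apply: subsetUr | right].
- move=> X fX iX cX; have := Phi_internal_ge fX iX fP' iP' coverP'.
  by have := removedR' X cX; lra.
- move=> X fX cX; have := Phi_family_ge fX fP'.
  have : 0 <= 2 * c * m%:R by rewrite !mulr_ge0 // ltW.
  by lra.
rewrite lerD2l lerN2.
apply: (@le_trans _ _ ((3 * c / m%:R + 8 * c * n%:R / m%:R ^+ 2) * (K * n)%:R)).
  apply: ler_wpM2l; last by rewrite ler_nat crossing_le.
  by rewrite addr_ge0 // !mulr_ge0 ?invr_ge0 ?exprn_ge0 ?ler0n ?(ltW c_gt0).
rewrite le_eqVlt; apply/orP; left; apply/eqP; rewrite natrM; field.
by rewrite gt_eqF.
Qed.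

End Interpolation.

(** * Averages over full and internal families *)

Definition mean (R : numFieldType) (I : finType) (A : {set I}) (f : I -> R) : R :=
  (\sum_(i in A) f i) / #|A|%:R.

Lemma ge_mean (R : numFieldType) (I : finType) (A : {set I}) (f : I -> R) a :
  A != set0 -> (forall i, i \in A -> f i <= a) -> mean A f <= a.
Proof.
rewrite -card_gt0 => A0 fa; rewrite ler_pdivrMr ?ltr0n // mulr_natr -sumr_const.
exact: ler_sum.
Qed.

Lemma le_mean (R : numFieldType) (I : finType) (A : {set I}) (f : I -> R) a :
  A != set0 -> (forall i, i \in A -> a <= f i) -> a <= mean A f.
Proof.
rewrite -card_gt0 => A0 fa; rewrite ler_pdivlMr ?ltr0n // mulr_natr -sumr_const.
exact: ler_sum.
Qed.

Section MeanInterpolation.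
Variables (R : realFieldType) (T : finType) (U : {set T}) (K : nat).
Variables (h : {set {set T}} -> R) (c hi : R).
Implicit Types (A B D : {set T}) (P Q : {set {set T}}).

Definition full_families := [set P : {set {set T}} | block_family K P && (cover P == [set: T])].
Definition internal_families := [set P in full_families | internal U P].

(** After exchanging the sums, each [s] merely permutes the families of [F]. *)
Lemma mean_side_average (F : {set {set {set T}}}) :
  (forall s P, s \in side_perms U -> (relabel s P \in F) = (P \in F)) ->
  mean F (side_average U h) = mean F h.
Proof.
move=> stable; congr (_ / _); rewrite -mulr_suml exchange_big /=.
rewrite (eq_bigr (fun=> \sum_(P in F) h P)) => [|s sG].
  rewrite sumr_const -[_ *+ _]mulr_natr mulfK // pnatr_eq0 -lt0n.
  exact: side_perms_gt0.
rewrite [RHS](reindex_inj (@relabel_inj _ s)).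
by apply: eq_bigl => P; rewrite stable.
Qed.

Lemma relabel_full s P : (relabel s P \in full_families) = (P \in full_families).
Proof.
rewrite !inE relabel_family; congr (_ && _); rewrite cover_relabel.
have sT : s @: [set: T] = [set: T].
  by apply/setP => x; rewrite inE -[x](permKV s) imset_f.
by rewrite -[X in s @: _ == X]sT (inj_eq (@imset_perm_inj _ s)).
Qed.

Lemma relabel_internal_families s P : s \in side_perms U ->
  (relabel s P \in internal_families) = (P \in internal_families).
Proof.
have intE Q : (Q \in internal_families) = (Q \in full_families) && internal U Q by rewrite inE.
move=> sG; rewrite !intE relabel_full; congr (_ && _).
apply/idP/idP => [iP|]; last exact: relabel_internal.
have -> : P = relabel (s^-1)%g (relabel s P).
  by rewrite relabelM mulgV relabel_fix // => x _; rewrite perm1.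
by apply: relabel_internal iP; rewrite /side_perms groupV.
Qed.

Hypothesis K_gt0 : (0 < K)%N.
Hypothesis c_gt0 : 0 < c.
Hypothesis hi_le : hi <= c.
Hypothesis h_add_ge : forall B P, B \notin P -> h P - c <= h (B |: P).
Hypothesis h_add_le : forall B P, B \notin P -> h (B |: P) <= h P + hi.
Hypothesis h_negtype : forall Q A D (v : T -> R),
  (forall x, x \in D -> x \notin cover Q) ->
  \sum_(x in D) \sum_(y in D | y != x)
     v x * v y * (h ((x |: (y |: A)) |: Q) - h Q - hi)
  <= c * \sum_(x in D) v x ^+ 2.

(** Symmetrizing changes neither mean, and after it the bound holds for every pair of a full family
    and an internal one. *)
Lemma mean_interpolation (m : nat) : (0 < m)%N -> internal_families != set0 ->
  mean internal_families h -
    c * (4 * m%:R + 3 * (K * #|T|)%:R / m%:R + 8 * K%:R * #|T|%:R ^+ 2 / m%:R ^+ 2)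
  <= mean full_families h.
Proof.
move=> m_gt0 int0.
have full0 : full_families != set0.
  by case/set0Pn: int0 => P; rewrite inE => /andP[PF _]; apply/set0Pn; exists P.
rewrite -mean_side_average; last exact: relabel_internal_families.
rewrite -[leRHS]mean_side_average; last by move=> s P _; exact: relabel_full.
apply: le_mean => // P; rewrite inE => /andP[fP /eqP coverP].
rewrite lerBlDr; apply: ge_mean => // P'; rewrite !inE => /andP[/andP[fP' /eqP coverP'] iP'].
rewrite -lerBlDr; apply: (Phi_full_ge (U := U)) => //.
- exact: side_average_add_ge.
- move=> B Q BQ; apply: le_trans (side_average_add_le (hi := hi) _ _ BQ) _ => //.
  by rewrite lerD2l.
- exact: side_average_relabel.
- exact: (side_average_step (hi := hi)).
Qed.

End MeanInterpolation.

(** * Maxima of penalised assignments *)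

Section MaxFunctional.
Variables (R : realFieldType) (T X : finType) (x0 : X) (w : X -> R).
Variables (bad : {set T} -> X -> bool) (lo hi : R).
Implicit Types (A B D E : {set T}) (P Q : {set {set T}}) (S : {set X}).

Definition value P x : R := w x + \sum_(B in P) (if bad B x then lo else hi).

(** Seeding with [value P x0] makes this an attained maximum although the field has no least
    element. *)
Definition max_value P : R := \big[Order.max/value P x0]_x value P x.

Lemma max_value_ge P x : value P x <= max_value P.
Proof. exact: le_bigmax. Qed.

Lemma max_value_le P a : (forall x, value P x <= a) -> max_value P <= a.
Proof. by move=> h; apply/bigmax_leP; split=> // x _; apply: h. Qed.

Lemma max_value_attained P : exists x, max_value P = value P x.
Proof.
rewrite /max_value; apply: (big_ind (fun a => exists x, a = value P x)).
- by exists x0.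
- by move=> a b [x ->] [y ->]; rewrite maxEle; case: ifP => _; [exists y | exists x].
- by move=> x _; exists x.
Qed.

Hypothesis lo_le_hi : lo <= hi.

Lemma valueU1 P B x : B \notin P ->
  value (B |: P) x = value P x + (if bad B x then lo else hi).
Proof. by move=> BP; rewrite /value big_setU1 //= addrCA addrC. Qed.

Lemma max_value_add_ge P B : B \notin P -> max_value P + lo <= max_value (B |: P).
Proof.
move=> BP; have [x ->] := max_value_attained P.
by apply: le_trans (max_value_ge _ x); rewrite valueU1 // lerD2l; case: ifP.
Qed.

Lemma max_value_add_le P B : B \notin P -> max_value (B |: P) <= max_value P + hi.
Proof.
move=> BP; apply: max_value_le => x; rewrite valueU1 // lerD ?max_value_ge //.
by case: ifP.
Qed.

Let max0 (u : X -> R) : R := \big[Order.max/0]_z u z.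

Let max0_le (u : X -> R) a : 0 <= a -> (forall z, u z <= a) -> max0 u <= a.
Proof. by move=> a0 h; apply/bigmax_leP; split=> // x _; apply: h. Qed.

Let le_max0 (u : X -> R) z : u z <= max0 u.
Proof. exact: le_bigmax. Qed.

Let max0_ge0 (u : X -> R) : 0 <= max0 u.
Proof. exact: bigmax_ge_id. Qed.

(** All positive values are at least [t], so a slab of height [t] can be peeled off the maximum. *)
Let max0_layer (u : X -> R) t : 0 <= t ->
  (forall z, 0 < u z -> t <= u z) -> (forall z, 0 <= u z) -> (exists z, 0 < u z) ->
  max0 u = t + max0 (fun z => if 0 < u z then u z - t else 0).
Proof.
move=> t0 tu u0 [z zu]; set u' := fun z => _; apply/eqP; rewrite eq_le; apply/andP; split.
  apply: max0_le => [|y]; first by rewrite addr_ge0.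
  have := le_max0 u' y; rewrite {1}/u'; case: ifP => [_|/negbT]; first by rewrite lerBlDl.
  by rewrite -leNgt => uy _; apply: le_trans uy _; rewrite addr_ge0.
rewrite -lerBrDl; apply: max0_le => [|y].
  by rewrite subr_ge0 (le_trans (tu _ zu)).
rewrite /u'; case: ifP => _; first by rewrite lerD2r.
by rewrite subr_ge0 (le_trans (tu _ zu)).
Qed.

(** Positive semidefiniteness in the form of a Gram factorisation. *)
Hypothesis bad_psd : forall S A, exists (F : finType) (phi : F -> T -> R), forall x y,
  [forall z in S, bad (x |: (y |: A)) z]%:R = \sum_k phi k x * phi k y.

(** The full quadratic form is a sum of squares, and its diagonal is at most the sum of the
    [v x ^+ 2]. *)
Let layer_negtype S A D (v : T -> R) :
  - \sum_(x in D) \sum_(y in D | y != x)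
     v x * v y * [forall z in S, bad (x |: (y |: A)) z]%:R <= \sum_(x in D) v x ^+ 2.
Proof.
have [F [phi hphi]] := bad_psd S A.
set b := fun x y => [forall z in S, bad (x |: (y |: A)) z].
have psd : 0 <= \sum_(x in D) \sum_(y in D) v x * v y * (b x y)%:R.
  have -> : \sum_(x in D) \sum_(y in D) v x * v y * (b x y)%:R =
      \sum_k (\sum_(x in D) v x * phi k x) ^+ 2.
    under [RHS]eq_bigr => k _ do rewrite expr2 big_distrlr.
    rewrite [RHS]exchange_big; apply: eq_bigr => x _ /=.
    rewrite [RHS]exchange_big; apply: eq_bigr => y _ /=.
    by rewrite hphi mulr_sumr; apply: eq_bigr => k _; rewrite mulrACA.
  by apply: sumr_ge0 => k _; apply: sqr_ge0.
have diag : \sum_(x in D) v x * v x * (b x x)%:R <= \sum_(x in D) v x ^+ 2.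
  apply: ler_sum => x _; rewrite -expr2; case: (b x x); first by rewrite mulr1.
  by rewrite mulr0 sqr_ge0.
have split_diag : \sum_(x in D) \sum_(y in D) v x * v y * (b x y)%:R =
    \sum_(x in D) v x * v x * (b x x)%:R +
    \sum_(x in D) \sum_(y in D | y != x) v x * v y * (b x y)%:R.
  by rewrite -big_split; apply: eq_bigr => x xD; rewrite (bigD1 x).
by move: psd diag; rewrite split_diag /b; lra.
Qed.

(** Layer-cake induction on the number of positive values of [u]: the lowest layer, of height [t],
    contributes [t] times the inequality for a single level set. *)
Let relax_negtype (u : X -> R) A D (v : T -> R) : (forall z, 0 <= u z) ->
  \sum_(x in D) \sum_(y in D | y != x)
     v x * v y * (max0 (fun z => if bad (x |: (y |: A)) z then 0 else u z) - max0 u)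
  <= max0 u * \sum_(x in D) v x ^+ 2.
Proof.
have [k] := ubnP #|[set z | 0 < u z]|; elim: k u => // k IH u lek u0.
have sq0 : 0 <= \sum_(x in D) v x ^+ 2 by apply: sumr_ge0 => x _; apply: sqr_ge0.
have [S0|/set0Pn[z1]] := eqVneq [set z | 0 < u z] set0.
  have uz z : u z = 0.
    apply/eqP; rewrite eq_le u0 andbT leNgt; apply/negP => uz.
    by move/setP: S0 => /(_ z); rewrite !inE uz.
  rewrite big1 ?mulr_ge0 // => x _; rewrite big1 // => y _.
  have -> : max0 u = 0.
    by apply/eqP; rewrite eq_le max0_ge0 andbT; apply: max0_le => // z; rewrite uz.
  rewrite subr0; apply/eqP; rewrite mulf_eq0; apply/orP; right.
  by rewrite eq_le max0_ge0 andbT; apply: max0_le => // z; rewrite uz if_same.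
rewrite inE => uz1.
have [z2 uz2 minz] := @arg_minP _ R X z1 (fun z => 0 < u z) u uz1.
set t := u z2; set S := [set z | 0 < u z] in lek *.
pose u' z := if 0 < u z then u z - t else 0.
have u'0 z : 0 <= u' z by rewrite /u'; case: ifP => // uz; rewrite subr_ge0 minz.
have eM : max0 u = t + max0 u' by apply: max0_layer => //; [exact: ltW | exists z1].
(* If [E] is bad on all of [S], both maxima vanish; otherwise a surviving assignment of [S] keeps
   the whole layer. *)
have ef E : max0 (fun z => if bad E z then 0 else u z) =
    t * (1 - [forall z in S, bad E z]%:R) + max0 (fun z => if bad E z then 0 else u' z).
  case: (boolP [forall z in S, bad E z]) => [/forall_inP allbad|/forall_inPn[z3 z3S z3E]].
    have bz (z : X) : (if bad E z then 0 else u z) = 0.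
      case: ifP => // /negbT nb; apply/eqP; rewrite eq_le u0 andbT leNgt.
      by apply: contra nb => uz; apply: allbad; rewrite inE.
    have bz' (z : X) : (if bad E z then 0 else u' z) = 0.
      move: (bz z); rewrite /u'; case: ifP => // _ ->; by rewrite ltxx.
    have z0 (f : X -> R) : (forall z, f z = 0) -> max0 f = 0.
      by move=> f0; apply/eqP; rewrite eq_le max0_ge0 andbT; apply: max0_le => // z; rewrite f0.
    by rewrite !z0 // subrr mulr0 addr0.
  rewrite subr0 mulr1 (@max0_layer _ t).
  - by congr (_ + _); apply: eq_bigr => z _; rewrite /u'; case: (bad E z); rewrite ?ltxx.
  - exact: ltW.
  - by move=> z; case: ifP; rewrite ?ltxx // => _; apply: minz.
  - by move=> z; case: ifP.
  - by exists z3; rewrite (negPf z3E); move: z3S; rewrite inE.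
have := IH u' _ u'0; have := layer_negtype S A D v.
move=> h1 h2; rewrite eM mulrDl; apply: le_trans (lerD (ler_wpM2l (ltW uz2) h1) (h2 _)); last first.
  rewrite -ltnS (leq_trans _ lek) // ltnS; apply: proper_card; apply/properP; split.
    by apply/subsetP => z; rewrite !inE /u'; case: ifP => //; rewrite ltxx.
  by exists z2; rewrite !inE ?uz2 // /u' uz2 subrr ltxx.
rewrite mulrN mulr_sumr -sumrN -big_split /=.
rewrite le_eqVlt; apply/orP; left; apply/eqP; apply: eq_bigr => x _.
rewrite mulr_sumr -sumrN -big_split /=; apply: eq_bigr => y _.
by rewrite ef -/t; ring.
Qed.

(* With [u z] the part of [value Q z] above [max_value Q - (hi - lo)], adding a block
   raises the maximum by [lo] plus the maximum of [u] over the assignments that are not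
   bad for it. *)
Lemma max_value_negtype Q A D (v : T -> R) :
  (forall x, x \in D -> x \notin cover Q) ->
  \sum_(x in D) \sum_(y in D | y != x)
     v x * v y * (max_value ((x |: (y |: A)) |: Q) - max_value Q - hi)
  <= (hi - lo) * \sum_(x in D) v x ^+ 2.
Proof.
move=> DQ; pose u z := Order.max 0 (value Q z + (hi - lo) - max_value Q).
have u0 z : 0 <= u z by rewrite le_max lexx.
have d0 : 0 <= hi - lo by rewrite subr_ge0.
have [y0 y0E] := max_value_attained Q.
have eu : max0 u = hi - lo.
  apply/eqP; rewrite eq_le; apply/andP; split.
    apply: max0_le => // z; rewrite ge_max d0 /=.
    by have := max_value_ge Q z; lra.
  apply: le_trans (le_max0 u y0); rewrite le_max; apply/orP; right.
  by rewrite y0E; lra.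
have := relax_negtype A D v u0; rewrite eu; apply: le_trans.
rewrite le_eqVlt; apply/orP; left; apply/eqP; apply: eq_bigr => x xD; apply: eq_bigr => y _.
set E := x |: (y |: A); congr (_ * _).
have EQ : E \notin Q.
  by apply: contraNN (DQ x xD) => EQ; apply/bigcupP; exists E; rewrite ?inE ?eqxx.
have -> : max_value (E |: Q) =
    max_value Q + lo + max0 (fun z => if bad E z then 0 else u z).
  apply/eqP; rewrite eq_le; apply/andP; split.
    apply: max_value_le => z; rewrite valueU1 //.
    have := le_max0 (fun z => if bad E z then 0 else u z) z.
    case: ifP => _ h1; first by have := max_value_ge Q z; lra.
    have : value Q z + (hi - lo) - max_value Q <= u z by rewrite le_max lexx orbT.
    by lra.
  rewrite addrC -lerBrDr; apply: max0_le => [|z].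
    by rewrite subr_ge0 max_value_add_ge.
  have := max_value_ge (E |: Q) z; have := max_value_add_ge EQ; rewrite valueU1 //.
  case: ifP => _ h1 h2; first by lra.
  by rewrite ge_max; apply/andP; split; lra.
by ring.
Qed.

End MaxFunctional.

(** * Positive semidefiniteness of the bad-block kernels *)

Section ColoredBlocks.
Variables (R : realFieldType) (T X : finType) (pinned : bool) (col : T -> X -> nat).
Implicit Types (A B E : {set T}) (S : {set X}).

(** Covers all six models: a block is bad when its points all have color 1 (pinned: independent
    sets, K-SAT) or all have the same color (the other models). *)
Definition color_bad E (z : X) : bool :=
  if pinned then [forall p in E, col p z == 1%N]
  else [forall p in E, [forall p' in E, col p z == col p' z]].

(** If colors are pinned or [A] has a point to compare with, the conditions on [x] and [y] separate
    and the kernel has rank one. Otherwise it is the indicator of an equivalence relation, a Gram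
    matrix of class indicators. *)
Lemma color_bad_psd S A : exists (F : finType) (phi : F -> T -> R), forall x y,
  [forall z in S, color_bad (x |: (y |: A)) z]%:R = \sum_k phi k x * phi k y.
Proof.
have rank1 (g : T -> bool) b : (forall x y,
    [forall z in S, color_bad (x |: (y |: A)) z] = [&& b, g x & g y]) ->
    exists (F : finType) (phi : F -> T -> R), forall x y,
    [forall z in S, color_bad (x |: (y |: A)) z]%:R = \sum_k phi k x * phi k y.
  move=> h; exists unit, (fun _ x => (b && g x)%:R) => x y.
  rewrite h (big_pred1 tt) => [|[]//].
  by rewrite -natrM mulnb; case: b (g x) (g y) {h} => [] [] [].
rewrite /color_bad in rank1 *; case: (pinned) rank1 => rank1.
  apply: (rank1 (fun x => [forall z in S, col x z == 1%N])
    [forall z in S, [forall p in A, col p z == 1%N]]) => x y.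
  apply/forall_inP/and3P => [h|[/forall_inP hA /forall_inP hx /forall_inP hy] z zS].
    split; apply/forall_inP => z zS; have /forall_inP hz := h z zS.
    - by apply/forall_inP => p pA; apply: hz; rewrite !inE pA !orbT.
    - by apply: hz; rewrite !inE eqxx.
    - by apply: hz; rewrite !inE eqxx orbT.
  apply/forall_inP => p; rewrite !inE => /or3P[/eqP ->|/eqP ->|pA]; [exact: hx|exact: hy|].
  exact: (forall_inP (hA z zS)).
pose sim x y := [forall z in S, col x z == col y z].
have simP x y : reflect (forall z, z \in S -> col x z = col y z) (sim x y).
  by apply: (iffP forall_inP) => h z zS; apply/eqP; rewrite ?h.
have [A0|/set0Pn[a aA]] := eqVneq A set0; last first.
  apply: (rank1 (sim a)
    [forall z in S, [forall p in A, [forall p' in A, col p z == col p' z]]]) => x y.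
  apply/forall_inP/and3P => [h|[/forall_inP hA /simP hx /simP hy] z zS].
    have hz z p p' : z \in S -> p \in x |: (y |: A) -> p' \in x |: (y |: A) -> col p z = col p' z.
      by move=> /h/forall_inP h1 /h1/forall_inP h2 /h2/eqP.
    split; [apply/forall_inP => z zS | apply/simP => z zS | apply/simP => z zS].
    - apply/forall_inP => p pA; apply/forall_inP => p' p'A; apply/eqP.
      by apply: hz; rewrite ?inE ?pA ?p'A ?orbT.
    - by apply: hz; rewrite ?inE ?aA ?eqxx ?orbT.
    - by apply: hz; rewrite ?inE ?aA ?eqxx ?orbT.
  have ha p : p \in x |: (y |: A) -> col p z = col a z.
    rewrite !inE => /or3P[/eqP ->|/eqP ->|pA]; [by rewrite hx | by rewrite hy |].
    by apply/eqP; have /forall_inP/(_ p pA)/forall_inP := hA z zS; apply.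
  by apply/forall_inP => p /ha ->; apply/forall_inP => p' /ha ->.
(* A canonical representative of the class of [x]: the choice depends only on the predicate [sim x],
   and the default is never reached by reflexivity. *)
pose rep x := odflt x [pick y | sim x y].
have sim_rep x : sim x (rep x).
  rewrite /rep; case: pickP => [//|/(_ x)]; suff -> : sim x x by [].
  exact/simP.
have repE x y : (rep x == rep y) = sim x y.
  apply/eqP/idP => [e|/simP xy].
    have /simP hx := sim_rep x; have /simP hy := sim_rep y.
    by apply/simP => z zS; rewrite hx // e -hy.
  rewrite /rep; rewrite (@eq_pick _ (sim x) (sim y)); last first.
    by move=> u; apply/simP/simP => h z zS; rewrite -h // xy.
  case: pickP => [//|/(_ y)]; suff -> : sim y y by [].
  exact/simP.
exists T, (fun k x => (rep x == k)%:R) => x y.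
rewrite (bigD1 (rep x)) //= eqxx mul1r big1 ?addr0 => [|k kx]; last first.
  by rewrite eq_sym (negPf kx) mul0r.
rewrite eq_sym repE; congr (nat_of_bool _)%:R.
apply/forall_inP/simP => [h z zS|h z zS].
  have /forall_inP/(_ x) := h z zS; rewrite !inE eqxx => /(_ isT)/forall_inP/(_ y).
  by rewrite !inE eqxx orbT => /(_ isT)/eqP.
have hx p : p \in x |: (y |: A) -> col p z = col x z.
  by rewrite A0 !inE orbF => /orP[] /eqP -> //; rewrite h.
by apply/forall_inP => p /hx ->; apply/forall_inP => p' /hx ->.
Qed.

End ColoredBlocks.

Lemma color_bad_imset (T T' X X' : finType) (i : T -> T') pinned
    (col : T -> X -> nat) (col' : T' -> X' -> nat) (B : {set T}) z z' :
  (forall p, col' (i p) z' = col p z) ->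
  color_bad pinned col' (i @: B) z' = color_bad pinned col B z.
Proof.
move=> h; rewrite /color_bad; case: pinned.
  apply/forall_inP/forall_inP => hB p; first by move=> pB; rewrite -h hB ?imset_f.
  by case/imsetP => p' p'B ->; rewrite h hB.
apply/forall_inP/forall_inP => hB p.
  move=> pB; apply/forall_inP => p' p'B.
  by have /forall_inP/(_ (i p')) := hB (i p) (imset_f i pB); rewrite !h => -> //; apply: imset_f.
case/imsetP => p1 p1B ->; apply/forall_inP => _ /imsetP[p2 p2B ->].
by rewrite !h; have /forall_inP := hB p1 p1B; apply.
Qed.

(** With two spin values, differing from [a p] means equalling its negation, so a violated NAE
    clause is a block monochromatic for the color telling whether the spin agrees with the sign. *)
Lemma literal_monochromatic (T : finType) (E : {set T}) (y : T -> nat) (a : T -> bool) :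
  (forall p, (y p < 2)%N) ->
  [forall p in E, y p == a p] || [forall p in E, y p == ~~ a p] =
  [forall p in E, [forall p' in E, nat_of_bool (y p == a p) == nat_of_bool (y p' == a p')]].
Proof.
move=> y2; have yN p : (y p == ~~ a p) = (y p != a p).
  by have := y2 p; case: (y p) (a p) => [|[|]] // [].
apply/idP/idP => [/orP[] /forall_inP h|/forall_inP h].
- apply/forall_inP => p pE; by apply/forall_inP => p' p'E; rewrite !h.
- apply/forall_inP => p pE; apply/forall_inP => p' p'E; have := h p pE; have := h p' p'E.
  by rewrite !yN => /negPf -> /negPf ->.
apply/orP; have [_|/forall_inPn[p pE hp]] := boolP [forall p in E, y p == a p]; first by left.
right; apply/forall_inP => p' p'E; rewrite yN; have /forall_inP/(_ p' p'E) := h p pE.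
by rewrite (negPf hp); case: (y p' == a p').
Qed.

Lemma full_families_neq0 (T : finType) (K : nat) : (0 < K)%N -> (K %| #|T|)%N ->
  full_families T K != set0.
Proof.
move=> K0; rewrite -cardsT => /(exists_block_family K0)[P fP cP].
by apply/set0Pn; exists P; rewrite inE fP cP eqxx.
Qed.

(** * Internal families as pairs of families on the two sides *)

Section Gluing.
Variables (T1 T2 T : finType) (i1 : T1 -> T) (i2 : T2 -> T) (k : T -> T1 + T2) (K : nat).
Hypothesis K_gt0 : (0 < K)%N.
Hypothesis ki1 : forall x, k (i1 x) = inl x.
Hypothesis ki2 : forall x, k (i2 x) = inr x.
Hypothesis ik : forall p, match k p with inl x => i1 x | inr x => i2 x end = p.

Let i1_inj : injective i1.
Proof. by move=> x y /(congr1 k); rewrite !ki1 => -[]. Qed.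

Let i2_inj : injective i2.
Proof. by move=> x y /(congr1 k); rewrite !ki2 => -[]. Qed.

Let i12 x y : i1 x <> i2 y.
Proof. by move=> /(congr1 k); rewrite ki1 ki2. Qed.

Let iP p : (exists x, p = i1 x) \/ (exists y, p = i2 y).
Proof. by rewrite -[p]ik; case: (k p) => x; [left|right]; exists x. Qed.

Definition left_side : {set T} := [set i1 x | x : T1].

Let mem_left x : (i1 x \in left_side) = true.
Proof. exact: imset_f. Qed.

Let mem_right y : (i2 y \in left_side) = false.
Proof. by apply/negP => /imsetP[x _ /esym]; apply: i12. Qed.

Definition glue_blocks (P : {set {set T1}} * {set {set T2}}) : {set {set T}} :=
  [set i1 @: (B : {set T1}) | B in P.1] :|: [set i2 @: (B : {set T2}) | B in P.2].

Definition unglue_blocks (P : {set {set T}}) : {set {set T1}} * {set {set T2}} :=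
  ([set B : {set T1} | i1 @: B \in P], [set B : {set T2} | i2 @: B \in P]).

Let img1_inj : injective (fun B : {set T1} => i1 @: B).
Proof. exact: imset_inj. Qed.

Let img2_inj : injective (fun B : {set T2} => i2 @: B).
Proof. exact: imset_inj. Qed.

Let img12 (B : {set T1}) (C : {set T2}) x : x \in B -> i1 @: B <> i2 @: C.
Proof.
move=> xB e; have : i1 x \in i2 @: C by rewrite -e imset_f.
by case/imsetP => y _; apply: i12.
Qed.

(** Blocks are nonempty because [K] is positive, so an image under [i1] is never an image under
    [i2]. *)
Lemma glueK P : block_family K P.1 -> block_family K P.2 -> unglue_blocks (glue_blocks P) = P.
Proof.
case: P => P1 P2 /block_familyP[c1 _] /block_familyP[c2 _]; congr (_, _); apply/setP => B.
  rewrite !inE /= (mem_imset _ _ img1_inj); case: (B \in P1) => //=.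
  apply/negP => /imsetP[C CP]; have /card_gt0P[y yC] : (0 < #|C|)%N by rewrite c2.
  move=> e; have : i2 y \in i1 @: B by rewrite e imset_f.
  by case/imsetP => x _ /esym; apply: i12.
rewrite !inE /= (mem_imset _ _ img2_inj) orbC; case: (B \in P2) => //=.
apply/negP => /imsetP[C CP]; have /card_gt0P[y yC] : (0 < #|C|)%N by rewrite c1.
by move=> /esym; apply: img12 yC.
Qed.

Lemma glue_internal P : P.1 \in full_families T1 K -> P.2 \in full_families T2 K ->
  glue_blocks P \in internal_families left_side K.
Proof.
case: P => P1 P2; rewrite !inE /=.
move=> /andP[/block_familyP[c1 d1] /eqP v1] /andP[/block_familyP[c2 d2] /eqP v2].
apply/andP; split; [apply/andP; split|].
- apply/block_familyP; split=> [B|B C p].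
    by rewrite inE => /orP[] /imsetP[B' B'P ->]; rewrite card_imset //; auto.
  rewrite !inE => /orP[] /imsetP[B' B'P ->] /orP[] /imsetP[C' C'P ->] /imsetP[x xB ->].
  - by rewrite mem_imset // => xC; rewrite (d1 B' C' x).
  - by case/imsetP => y _ /i12.
  - by case/imsetP => y _ /esym/i12.
  - by rewrite mem_imset // => xC; rewrite (d2 B' C' x).
- apply/eqP/setP => p; rewrite inE; apply/bigcupP.
  have [[x ->]|[y ->]] := iP p.
    have /bigcupP[B BP xB] : x \in cover P1 by rewrite v1 inE.
    by exists (i1 @: B); rewrite ?imset_f // inE imset_f.
  have /bigcupP[B BP xB] : y \in cover P2 by rewrite v2 inE.
  by exists (i2 @: B); rewrite ?imset_f // inE [X in _ || X]imset_f ?orbT.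
- apply/forall_inP => B; rewrite inE => /orP[] /imsetP[B' B'P ->]; apply/orP; [left|right];
    by apply/subsetP => _ /imsetP[x _ ->]; rewrite ?inE ?mem_left ?mem_right.
Qed.

Let unglue_block P B : internal left_side P -> B \in P ->
  (exists2 B1 : {set T1}, B1 \in (unglue_blocks P).1 & B = i1 @: B1) \/
  (exists2 B2 : {set T2}, B2 \in (unglue_blocks P).2 & B = i2 @: B2).
Proof.
move=> /forall_inP/(_ B) intB BP; case/orP: (intB BP) => /subsetP sB; [left|right].
  have e : B = i1 @: (i1 @^-1: B).
    apply/setP => p; apply/idP/imsetP => [pB|[x]]; last by rewrite inE => ? ->.
    by have /imsetP[x _ px] := sB p pB; exists x; rewrite // inE -px.
  by exists (i1 @^-1: B); rewrite // inE -e.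
have e : B = i2 @: (i2 @^-1: B).
  apply/setP => p; apply/idP/imsetP => [pB|[x]]; last by rewrite inE => ? ->.
  have := sB p pB; rewrite inE; case: (iP p) => [[x ->]|[y py]]; first by rewrite mem_left.
  by exists y; rewrite // inE -py.
by exists (i2 @^-1: B); rewrite // inE -e.
Qed.

Lemma unglueK P : internal left_side P -> glue_blocks (unglue_blocks P) = P.
Proof.
move=> intP; apply/setP => B; rewrite inE; apply/orP/idP => [|BP].
  by case=> /imsetP[B']; rewrite inE => B'P ->.
by case: (unglue_block intP BP) => -[B' B'P ->]; [left|right]; apply/imsetP; exists B'.
Qed.

Lemma unglue_full P : P \in internal_families left_side K ->
  (unglue_blocks P).1 \in full_families T1 K /\ (unglue_blocks P).2 \in full_families T2 K.
Proof.
rewrite !inE => /andP[/andP[/block_familyP[cP dP] /eqP vP] iPt].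
split; apply/andP; split.
- apply/block_familyP; split=> [B|B C x]; rewrite !inE.
    by move=> /cP; rewrite card_imset.
  by move=> BP CP xB xC; apply: img1_inj; apply: (dP _ _ (i1 x)); rewrite ?imset_f.
- apply/eqP/setP => x; rewrite inE; apply/bigcupP.
  have /bigcupP[B BP xB] : i1 x \in cover P by rewrite vP inE.
  case: (unglue_block iPt BP) => -[B' B'P e]; rewrite e in xB.
    by exists B' => //; move: xB; rewrite mem_imset.
  by case/imsetP: xB => y _ /i12.
- apply/block_familyP; split=> [B|B C x]; rewrite !inE.
    by move=> /cP; rewrite card_imset.
  by move=> BP CP xB xC; apply: img2_inj; apply: (dP _ _ (i2 x)); rewrite ?imset_f.
apply/eqP/setP => x; rewrite inE; apply/bigcupP.
have /bigcupP[B BP xB] : i2 x \in cover P by rewrite vP inE.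
case: (unglue_block iPt BP) => -[B' B'P e]; rewrite e in xB.
  by case/imsetP: xB => y _ /esym/i12.
by exists B' => //; move: xB; rewrite mem_imset.
Qed.

(** Gluing and ungluing are inverse bijections, so a uniform internal family is a pair of
    independent uniform full families. *)
Lemma sum_internal (V : nmodType) (f : {set {set T}} -> V) :
  \sum_(P in internal_families left_side K) f P =
  \sum_(P1 in full_families T1 K) \sum_(P2 in full_families T2 K) f (glue_blocks (P1, P2)).
Proof.
rewrite (reindex_onto glue_blocks unglue_blocks) => [|P]; last first.
  by rewrite inE => /andP[_ /unglueK].
rewrite pair_big /=; apply: eq_big => [[P1 P2]|[P1 P2] _ //].
apply/andP/andP => [[/unglue_full + /eqP e]|[F1 F2]]; first by rewrite e.
split; first exact: glue_internal.
by rewrite glueK //; move: F1 F2; rewrite !inE => /andP[? _] /andP[].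
Qed.

Lemma sum_glue (V : nmodType) P1 P2 (f : {set T} -> V) :
  block_family K P1 -> block_family K P2 ->
  \sum_(B in glue_blocks (P1, P2)) f B =
  \sum_(B in P1) f (i1 @: B) + \sum_(B in P2) f (i2 @: B).
Proof.
move=> /block_familyP[c1 _] _.
set A1 := [set i1 @: (B : {set T1}) | B in P1].
set A2 := [set i2 @: (B : {set T2}) | B in P2].
have dis : [disjoint A1 & A2].
  rewrite -setI_eq0; apply/eqP/setP => E; rewrite !inE.
  apply/negP => /andP[/imsetP[B BP ->] /imsetP[C _]].
  have /card_gt0P[x xB] : (0 < #|B|)%N by rewrite c1.
  exact: img12 xB.
rewrite (eq_bigl [predU A1 & A2]) => [|E]; last by rewrite !inE.
rewrite bigU // /A1 /A2.
by rewrite !big_imset //= => B C _ _; [apply: img2_inj | apply: img1_inj].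
Qed.

Lemma mean_internal_ge (R : realFieldType) (f : {set {set T}} -> R) f1 f2 :
  full_families T1 K != set0 -> full_families T2 K != set0 ->
  (forall P1 P2, P1 \in full_families T1 K -> P2 \in full_families T2 K ->
     f1 P1 + f2 P2 <= f (glue_blocks (P1, P2))) ->
  mean (full_families T1 K) f1 + mean (full_families T2 K) f2 <=
  mean (internal_families left_side K) f.
Proof.
set F1 := full_families T1 K; set F2 := full_families T2 K => F1n0 F2n0 hf.
have c1 : #|F1|%:R != 0 :> R by rewrite pnatr_eq0 cards_eq0.
have c2 : #|F2|%:R != 0 :> R by rewrite pnatr_eq0 cards_eq0.
have -> : mean F1 f1 + mean F2 f2 =
    (\sum_(P1 in F1) \sum_(P2 in F2) (f1 P1 + f2 P2)) / (#|F1|%:R * #|F2|%:R).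
  under [in RHS]eq_bigr do rewrite big_split /= sumr_const -mulr_natr.
  rewrite big_split /= sumr_const -mulr_suml -[_ *+ #|F1|]mulr_natr /mean; field.
  by rewrite c1 c2.
rewrite /mean sum_internal -natrM.
have -> : #|internal_families left_side K| = (#|F1| * #|F2|)%N.
  rewrite -sum1_card (sum_internal (fun=> 1%N)) -sum_nat_const.
  by apply: eq_bigr => P1 _; rewrite sum1_card.
rewrite ler_wpM2r ?invr_ge0 ?ler0n //.
by apply: ler_sum => P1 h1; apply: ler_sum => P2 h2; apply: hf.
Qed.

Lemma internal_families_neq0 : full_families T1 K != set0 -> full_families T2 K != set0 ->
  internal_families left_side K != set0.
Proof.
by move=> /set0Pn[P1 h1] /set0Pn[P2 h2]; apply/set0Pn; exists (glue_blocks (P1, P2)); apply: glue_internal.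
Qed.

Definition glue_fun (C : Type) (a : {ffun T1 -> C} * {ffun T2 -> C}) : {ffun T -> C} :=
  [ffun p => match k p with inl x => a.1 x | inr y => a.2 y end].

(** Uniform signs on [T] restrict to independent uniform signs on the two sides. The element [c0]
    makes the sets of functions nonempty. *)
Lemma mean_restrict (R : realFieldType) (C : finType) (c0 : C)
    (f1 : {ffun T1 -> C} -> R) (f2 : {ffun T2 -> C} -> R) :
  mean [set: {ffun T1 -> C}] f1 + mean [set: {ffun T2 -> C}] f2 =
  mean [set: {ffun T -> C}] (fun a => f1 [ffun x => a (i1 x)] + f2 [ffun y => a (i2 y)]).
Proof.
have bij : bijective (@glue_fun C).
  exists (fun a : {ffun T -> C} => ([ffun x => a (i1 x)], [ffun y => a (i2 y)])).
    by case=> a1 a2; congr (_, _); apply/ffunP => x; rewrite !ffunE ?ki1 ?ki2.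
  by move=> a; apply/ffunP => p; rewrite ffunE -[in RHS](ik p); case: (k p) => x; rewrite /= ffunE.
have cE (A : finType) : #|{ffun A -> C}|%:R != 0 :> R.
  by rewrite pnatr_eq0 -lt0n; apply/card_gt0P; exists [ffun=> c0].
rewrite /mean !cardsT -(bij_eq_card bij) card_prod natrM.
have -> : \sum_(a in [set: {ffun T -> C}]) (f1 [ffun x => a (i1 x)] + f2 [ffun y => a (i2 y)]) =
    \sum_(a1 : {ffun T1 -> C}) \sum_(a2 : {ffun T2 -> C}) (f1 a1 + f2 a2).
  rewrite (reindex (@glue_fun C)); last exact: onW_bij.
  rewrite pair_big /=; apply: eq_big => [a|[a1 a2] _ /=]; first by rewrite inE.
  by congr (f1 _ + f2 _); apply/ffunP => x; rewrite !ffunE ?ki1 ?ki2.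
under [in RHS]eq_bigr do rewrite big_split /= sumr_const -mulr_natr.
rewrite big_split /= sumr_const -mulr_suml -[_ *+ #|_|]mulr_natr.
under eq_bigl do rewrite inE.
under [X in _ + X / _]eq_bigl do rewrite inE.
field; by rewrite !cE.
Qed.

End Gluing.

(** * The models *)

(* Imported only here because the set notions of the classical library shadow those of
   [finset]. *)
From mathcomp Require Import all_classical all_reals all_analysis.
Import Order.TTheory GRing.Theory Num.Theory.
Local Open Scope ring_scope.

Local Notation points n r := (prod (ordinal n) (ordinal r)).

Section ModelValue.
Variables (R : realType) (m : model R).
Hypothesis m_ok : model_ok m.

Definition pinned : bool := match m with IndSet | KSAT _ => true | _ => false end.

(** In the SAT models the color records whether the spin equals the sign of the point, so that a
    violated clause becomes a constant coloring. *)
Definition spin_color (b : bool) (v : nat) : nat :=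
  match m with KSAT _ | NAEKSAT _ => nat_of_bool (v == b) | _ => v end.

Definition vertex_weight (v : nat) : R :=
  match m with
  | IndSet => if v == 1%N then 1 else 0
  | Ising _ B => if v == 1%N then B else - B
  | _ => 0
  end.

(* For independent sets the infinite penalty is replaced by [-1], which does not change
   the maximum: see [Hx_ge]. *)
Definition bad_gain : R :=
  match m with IndSet => -1 | Ising beta _ => - beta | _ => 0 end.

Definition good_gain : R :=
  match m with IndSet => 0 | Ising beta _ => beta | _ => 1 end.

Lemma bad_le_good : bad_gain <= good_gain.
Proof. by rewrite /bad_gain /good_gain; case: m m_ok => //= *; lra. Qed.

Lemma mK_gt0 : (0 < mK m)%N.
Proof. by case: m m_ok => //= K /ltnW. Qed.

Lemma mq_gt0 : (0 < mq m)%N.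
Proof. by case: m m_ok. Qed.

Definition zero_spins n : {ffun 'I_n -> 'I_(mq m)} := [ffun=> Ordinal mq_gt0].

Definition point_color n r (a : {ffun points n r -> bool}) (p : points n r)
  (x : {ffun 'I_n -> 'I_(mq m)}) : nat := spin_color (a p) (x p.1).

Definition total_weight n (x : {ffun 'I_n -> 'I_(mq m)}) : R :=
  \sum_i vertex_weight (x i).

Definition Hvalue n r (a : {ffun points n r -> bool}) (P : {set {set points n r}})
    (x : {ffun 'I_n -> 'I_(mq m)}) : R :=
  value (@total_weight n) (color_bad pinned (point_color a)) bad_gain good_gain P x.

Definition Hmax n r (a : {ffun points n r -> bool}) (P : {set {set points n r}}) : R :=
  max_value (zero_spins n) (@total_weight n) (color_bad pinned (point_color a))
    bad_gain good_gain P.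

Lemma HvertE v : Hvert m v = (vertex_weight v)%:E.
Proof. by rewrite /Hvert /vertex_weight; case: m. Qed.

Lemma Hedge_color n r (a : {ffun points n r -> bool}) (B : {set points n r})
    (x : {ffun 'I_n -> 'I_(mq m)}) :
  (m = IndSet -> ~~ color_bad pinned (point_color a) B x) ->
  Hedge m B (fun p => nat_of_ord (x p.1)) a =
  (if color_bad pinned (point_color a) B x then bad_gain else good_gain)%:E.
Proof.
rewrite /Hedge /color_bad /point_color /pinned /spin_color /bad_gain /good_gain.
case: m x => [||beta b|q|K|K] //= x.
- by move=> /(_ erefl)/negPf ->.
- move=> _; suff -> : [forall p in B, nat_of_bool (x p.1 == a p :> nat) == 1%N] =
    [forall p in B, x p.1 == a p :> nat] by [].
  by apply/forall_inP/forall_inP => h p pB; have := h p pB; rewrite eqb1.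
- by move=> _; rewrite literal_monochromatic // => p; apply: ltn_ord.
Qed.

Lemma Hedge_IndSet_bad n r (a : {ffun points n r -> bool}) (B : {set points n r})
    (x : {ffun 'I_n -> 'I_(mq m)}) :
  m = IndSet -> color_bad pinned (point_color a) B x ->
  Hedge m B (fun p => nat_of_ord (x p.1)) a = -oo%E.
Proof.
rewrite /Hedge /color_bad /point_color /pinned /spin_color.
by case: m x => //= x _ ->.
Qed.

Let Hvert_sum n (x : {ffun 'I_n -> 'I_(mq m)}) :
  (\sum_i Hvert m (x i))%E = (total_weight x)%:E.
Proof. by rewrite -sumEFin; apply: eq_bigr => i _; rewrite HvertE. Qed.

Lemma Hx_le n r (a : {ffun points n r -> bool}) (P : {set {set points n r}}) x :
  (@Hx R m n r P a x <= (Hvalue a P x)%:E)%E.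
Proof.
rewrite /Hx /Hvalue /value EFinD Hvert_sum leeD2l // -sumEFin; apply: lee_sum => B _.
have [bad|good] := boolP (color_bad pinned (point_color a) B x); last first.
  by rewrite Hedge_color // (negPf good).
have [mI|mI] : m = IndSet \/ m <> IndSet by case: m => *; auto; right.
  by rewrite Hedge_IndSet_bad ?leNye.
by rewrite Hedge_color ?bad.
Qed.

Lemma Hx_eq n r (a : {ffun points n r -> bool}) (P : {set {set points n r}}) x :
  (m = IndSet -> forall B, B \in P -> ~~ color_bad pinned (point_color a) B x) ->
  @Hx R m n r P a x = (Hvalue a P x)%:E.
Proof.
move=> good; rewrite /Hx /Hvalue /value EFinD Hvert_sum; congr (_ + _)%E; rewrite -sumEFin.
by apply: eq_bigr => B BP; rewrite Hedge_color // => /good; apply.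
Qed.

Lemma color_bad_IndSet n r (a : {ffun points n r -> bool}) (B : {set points n r}) x :
  m = IndSet -> color_bad pinned (point_color a) B x = [forall p in B, x p.1 == 1%N :> nat].
Proof. by rewrite /color_bad /pinned /point_color /spin_color; case: m x. Qed.

Lemma weights_IndSet : m = IndSet ->
  [/\ bad_gain = -1, good_gain = 0 & forall v, vertex_weight v = (v == 1%N)%:R].
Proof.
by rewrite /bad_gain /good_gain /vertex_weight => ->; split=> // v; case: (v == 1%N).
Qed.

(* In an independent-set instance, removing one vertex of every violated edge loses at
   most the total penalty. *)
Lemma Hx_ge n r (a : {ffun points n r -> bool}) (P : {set {set points n r}}) x :
  (forall B, B \in P -> B != finset.set0) ->
  exists x', ((Hvalue a P x)%:E <= @Hx R m n r P a x')%E.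
Proof.
move=> Pn0.
have [mI|mI] : m = IndSet \/ m <> IndSet by case: m => *; auto; right.
  pose viol := finset (fun B => (B \in P) && color_bad pinned (point_color a) B x).
  have [v0|/finset.set0Pn[B0]] := eqVneq viol finset.set0.
    exists x; rewrite Hx_eq // => _ B BP; apply/negP => bad.
    by have := finset.in_set0 B; rewrite -v0 inE BP bad.
  rewrite inE => /andP[/Pn0/finset.set0Pn[p0 _] _].
  pose pt (B : {set points n r}) := odflt p0 [pick p in B].
  have ptB B : B \in P -> pt B \in B.
    move=> /Pn0/finset.set0Pn[p pB]; rewrite /pt; case: pickP => [//|/(_ p)].
    by rewrite pB.
  (* The vertices to be removed. Chosen points may share an owner, so there are at most as many as
     violated edges. *)
  pose own : {set 'I_n} := imset (fun B => (pt B).1) (mem viol).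
  pose x' : {ffun 'I_n -> 'I_(mq m)} :=
    [ffun i => if i \in own then zero_spins n i else x i].
  (* Setting spins to 0 violates no new edge, and each violated edge has lost its chosen vertex. *)
  have good B : B \in P -> ~~ color_bad pinned (point_color a) B x'.
    move=> BP; rewrite color_bad_IndSet //.
    have one (p : points n r) : (x' p.1 == 1%N :> nat) -> (x p.1 == 1%N :> nat) && (p.1 \notin own).
      by rewrite /x' ffunE; case: ifP => [_|_ ->] //; rewrite /zero_spins ffunE.
    apply/negP => /forall_inP h.
    have : B \in viol.
      rewrite inE BP color_bad_IndSet //.
      by apply/forall_inP => p /h/one/andP[].
    move=> Bv; have /andP[_ /negP] := one (pt B) (h _ (ptB _ BP)); apply.
    by apply/imsetP; exists B.
  have [bE gE wE] := weights_IndSet mI.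
  exists x'; rewrite Hx_eq // lee_fin /Hvalue /value.
  have -> : \sum_(B in P) (if color_bad pinned (point_color a) B x' then bad_gain
      else good_gain) = 0.
    by rewrite big1 // => B /good/negPf ->.
  have -> : \sum_(B in P) (if color_bad pinned (point_color a) B x then bad_gain
      else good_gain) = - #|viol|%:R.
    rewrite -sumr_const -sumrN bE gE -big_mkcondr /=.
    by apply: eq_bigl => B; rewrite inE.
  have own_le : #|own|%:R <= #|viol|%:R :> R by rewrite ler_nat leq_imset_card.
  rewrite addr0 lerBlDr; apply: le_trans (lerD (lexx _) own_le).
  rewrite -sumr_const big_mkcond -big_split; apply: ler_sum => i _.
  rewrite !wE /x' ffunE /=; case: ifP => _; last by rewrite addr0.
  by rewrite /zero_spins ffunE /= add0r lern1 leq_b1.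
by exists x; rewrite Hx_eq.
Qed.

Lemma HG_Hmax n r (a : {ffun points n r -> bool}) (P : {set {set points n r}}) :
  (forall B, B \in P -> B != finset.set0) -> HG m P a = (Hmax a P)%:E.
Proof.
move=> Pn0; apply/eqP; rewrite eq_le; apply/andP; split.
  apply/bigmax_leP; split=> [|x _]; first exact: leNye.
  by apply: le_trans (Hx_le _ _ _) _; rewrite lee_fin; apply: max_value_ge.
rewrite /Hmax; have [x ->] := max_value_attained (zero_spins n) (@total_weight n)
  (color_bad pinned (point_color a)) bad_gain good_gain P.
have [x' h] := Hx_ge a x Pn0; apply: le_trans h _.
exact: (le_bigmax _ (fun x => Hx P a x)).
Qed.

(** The signs form the outer average because the interpolation runs with the signs fixed. *)
Definition mean_H n r : R :=
  mean [set: {ffun points n r -> bool}]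
    (fun a => mean (full_families _ (mK m)) (Hmax a)).

Lemma full_block_neq0 n r (P : {set {set points n r}}) (B : {set points n r}) :
  P \in full_families _ (mK m) -> B \in P -> B != finset.set0.
Proof.
rewrite inE => /andP[/block_familyP[cP _] _] /cP cB.
by rewrite -card_gt0 cB mK_gt0.
Qed.

Lemma block_partitionsE n r : block_partitions n r (mK m) = full_families _ (mK m).
Proof.
apply/setP => P; rewrite !inE /block_family /finset.partition.
have [cK|_] := boolP [forall B in P, #|B| == mK m]; last by rewrite !andbF.
rewrite !andbT andbC -andbA; congr (_ && _); rewrite andbC.
have -> : finset.set0 \notin P.
  apply/negP => /(forall_inP cK); rewrite finset.cards0 => /eqP e.
  by have := mK_gt0; rewrite -e.
by rewrite andbT.
Qed.

Lemma EH_mean n r : EH m n r = (mean_H n r)%:E.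
Proof.
rewrite /EH block_partitionsE.
set w : R := (_%:R)^-1.
transitivity (\sum_(P in full_families (points n r) (mK m))
    \sum_(a : {ffun points n r -> bool}) (w * Hmax a P)%:E)%E.
  apply: eq_bigr => P PF; apply: eq_bigr => a _.
  by rewrite HG_Hmax // => B; apply: full_block_neq0 PF.
under eq_bigr do rewrite sumEFin; rewrite sumEFin; congr (_%:E).
rewrite exchange_big /= /mean_H /mean mulr_suml; apply: eq_big => [a|a _]; first by rewrite inE.
rewrite -mulr_sumr mulrC -mulrA; congr (_ * _).
by rewrite /w natrM invfM; congr (_ * _^-1); rewrite -[in LHS]cardsT; congr (#|_|%:R); apply/setP => b; rewrite !inE.
Qed.

End ModelValue.

(** * Superadditivity of the mean optimum *)

Section Superadditivity.
Variables (R : realType) (m : model R).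
Hypothesis m_ok : model_ok m.
Variables (N1 N2 r : nat).

Definition lpoint (p : points N1 r) : points (N1 + N2) r := (lshift N2 p.1, p.2).

Definition rpoint (p : points N2 r) : points (N1 + N2) r := (rshift N1 p.1, p.2).

Definition side_point (p : points (N1 + N2) r) : points N1 r + points N2 r :=
  match fintype.split p.1 with inl i => inl (i, p.2) | inr j => inr (j, p.2) end.

Lemma lpointK p : side_point (lpoint p) = inl p.
Proof. by rewrite /side_point /= -[lshift N2 p.1]/(unsplit (inl p.1)) unsplitK; case: p. Qed.

Lemma rpointK p : side_point (rpoint p) = inr p.
Proof. by rewrite /side_point /= -[rshift N1 p.1]/(unsplit (inr p.1)) unsplitK; case: p. Qed.

Lemma side_pointK p : match side_point p with inl x => lpoint x | inr x => rpoint x end = p.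
Proof.
by case: p => i j; rewrite /side_point /=; case: fintype.split_ordP => k ->.
Qed.

(** Two optimal assignments, placed side by side, form an assignment of the glued instance with the
    sum of their values. *)
Lemma Hmax_glue (a : {ffun points (N1 + N2) r -> bool}) P1 P2 :
  block_family (mK m) P1 -> block_family (mK m) P2 ->
  Hmax m_ok [ffun p => a (lpoint p)] P1 + Hmax m_ok [ffun p => a (rpoint p)] P2 <=
  Hmax m_ok a (glue_blocks lpoint rpoint (P1, P2)).
Proof.
move=> f1 f2; rewrite /Hmax.
have [x1 ->] := max_value_attained (zero_spins m_ok N1) (@total_weight _ m N1)
  (color_bad (pinned m) (point_color [ffun p => a (lpoint p)])) (bad_gain m) (good_gain m) P1.
have [x2 ->] := max_value_attained (zero_spins m_ok N2) (@total_weight _ m N2)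
  (color_bad (pinned m) (point_color [ffun p => a (rpoint p)])) (bad_gain m) (good_gain m) P2.
pose x : {ffun 'I_(N1 + N2) -> 'I_(mq m)} :=
  [ffun i => match fintype.split i with inl i1 => x1 i1 | inr i2 => x2 i2 end].
have xl i : x (lshift N2 i) = x1 i by rewrite ffunE -[lshift N2 i]/(unsplit (inl i)) unsplitK.
have xr i : x (rshift N1 i) = x2 i by rewrite ffunE -[rshift N1 i]/(unsplit (inr i)) unsplitK.
apply: le_trans (max_value_ge _ _ _ _ _ _ x).
rewrite /value (sum_glue (mK_gt0 m_ok) lpointK rpointK) //.
rewrite {3}/total_weight big_split_ord /= addrACA le_eqVlt; apply/orP; left; apply/eqP.
congr (_ + _ + (_ + _)).
- by apply: eq_bigr => i _; rewrite xl.
- by apply: eq_bigr => i _; rewrite xr.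
- apply: eq_bigr => B _; congr (if _ then _ else _); apply/esym/color_bad_imset => p.
  by rewrite /point_color /= xl ffunE.
- apply: eq_bigr => B _; congr (if _ then _ else _); apply/esym/color_bad_imset => p.
  by rewrite /point_color /= xr ffunE.
Qed.

(** Dominates [good_gain], [- bad_gain] and their sum; the added 1 makes it positive. *)
Definition gain_bound : R := `|bad_gain m| + `|good_gain m| + 1.

(** The sign averages of the two parts merge into one over all points. For each sign array, gluing
    bounds the two optima by the internal mean, which the interpolation compares with the full
    mean. *)
Lemma mean_H_superadditive (M : nat) :
  (0 < M)%N -> (mK m %| N1 * r)%N -> (mK m %| N2 * r)%N ->
  mean_H m_ok N1 r + mean_H m_ok N2 r -
    gain_bound * (4 * M%:R + 3 * (mK m * ((N1 + N2) * r))%:R / M%:R +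
      8 * (mK m)%:R * ((N1 + N2) * r)%:R ^+ 2 / M%:R ^+ 2)
  <= mean_H m_ok (N1 + N2) r.
Proof.
move=> M_gt0 d1 d2; set err := gain_bound * _.
have K0 := mK_gt0 m_ok; have lh := bad_le_good m_ok.
have cardT N : #|(points N r : finType)| = (N * r)%N by rewrite card_prod !card_ord.
have F1 : full_families (points N1 r) (mK m) != finset.set0.
  by apply: full_families_neq0; rewrite ?cardT.
have F2 : full_families (points N2 r) (mK m) != finset.set0.
  by apply: full_families_neq0; rewrite ?cardT.
have int0 := internal_families_neq0 lpointK rpointK side_pointK F1 F2.
have c0 : 0 < gain_bound by rewrite /gain_bound ltr_wpDl ?addr_ge0.
have lo_c : - bad_gain m <= gain_bound.
  have := ler_norm (- bad_gain m); rewrite normrN /gain_bound.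
  by have := normr_ge0 (good_gain m); lra.
have hi_c : good_gain m <= gain_bound.
  have := ler_norm (good_gain m); rewrite /gain_bound.
  by have := normr_ge0 (bad_gain m); lra.
have hilo_c : good_gain m - bad_gain m <= gain_bound.
  have := ler_norm (good_gain m); have := ler_norm (- bad_gain m).
  by rewrite normrN /gain_bound; lra.
rewrite {1 2}/mean_H.
rewrite (mean_restrict lpointK rpointK side_pointK false).
rewrite lerBlDr /mean_H.
have -> : forall f : {ffun points (N1 + N2) r -> bool} -> R,
    mean [set: {ffun points (N1 + N2) r -> bool}] f + err =
    mean [set: {ffun points (N1 + N2) r -> bool}] (fun a => f a + err).
  move=> f; rewrite /mean big_split /= sumr_const mulrDl -[err *+ _]mulr_natr mulfK //.
  rewrite pnatr_eq0 -lt0n; apply/card_gt0P; exists [ffun=> false]; by rewrite inE.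
rewrite /mean ler_wpM2r ?invr_ge0 ?ler0n //; apply: ler_sum => a _.
rewrite -lerBlDr.
have := @mean_interpolation R _ (left_side lpoint) (mK m) (Hmax m_ok a) gain_bound
  (good_gain m) K0 c0 hi_c _ _ _ M M_gt0 int0.
rewrite cardT -/err => main; apply: le_trans (main _ _ _).
- rewrite lerD2r; apply: (mean_internal_ge K0 lpointK rpointK side_pointK F1 F2) => P1 P2.
  by rewrite !inE => /andP[f1 _] /andP[f2 _]; apply: Hmax_glue.
- move=> B P BP; apply: le_trans (max_value_add_ge _ _ _ lh BP).
  by rewrite lerD2l; lra.
- by move=> B P BP; apply: max_value_add_le.
move=> Q A D v DQ; apply: le_trans (max_value_negtype _ _ lh _ _ _ DQ) _.
  by move=> S B; apply: color_bad_psd.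
by rewrite ler_wpM2r // sumr_ge0 // => x _; apply: sqr_ge0.
Qed.

End Superadditivity.

(** Settles [N1 + N2 = 0], where the error term vanishes. *)
Lemma mean_H0 (R : realType) (m : model R) (m_ok : model_ok m) r : mean_H m_ok 0 r = 0.
Proof.
have T0 : #|(points 0 r : finType)| = 0%N by rewrite card_prod !card_ord.
rewrite /mean_H /mean big1 ?mul0r // => a _; rewrite big1 ?mul0r // => P.
rewrite inE => /andP[fP _].
have P0 : P = finset.set0.
  by have := card_family_le (mK_gt0 m_ok) fP; rewrite T0 leqn0 cards_eq0 => /eqP.
rewrite /Hmax; have [x ->] := max_value_attained (zero_spins m_ok 0) (@total_weight _ m 0)
  (color_bad (pinned m) (point_color a)) (bad_gain m) (good_gain m) P.
by rewrite /value P0 finset.big_set0 /total_weight big_ord0 addr0.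
Qed.

(* Every error term is at most of order [N^(5/6)] for [M] of order [y = N^(5/6)], because
   [N <= y^2] and [N^2 <= y^3]. *)
Lemma interpolation_error_le (R : realType) (N r K : nat) : (0 < N)%N ->
  exists2 M : nat, (0 < M)%N &
    4 * M%:R + 3 * (K * (N * r))%:R / M%:R + 8 * K%:R * (N * r)%:R ^+ 2 / M%:R ^+ 2
    <= (8 + 3 * (K * r)%:R + 8 * K%:R * r%:R ^+ 2) * (N%:R `^ (5 / 6)) :> R.
Proof.
move=> N0; set y : R := N%:R `^ (5 / 6).
have N1 : 1 <= N%:R :> R by rewrite ler1n.
have y1 : 1 <= y.
  by rewrite /y -[leLHS](powRr0 (N%:R : R)) ler_powR //; lra.
have y0 : 0 < y by lra.
have y6 : y ^+ 6 = N%:R ^+ 5.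
  rewrite /y -powR_mulrn ?powR_ge0 // -powRrM -powR_mulrn; last by lra.
  by congr (_ `^ _); field.
have Ny3 : N%:R ^+ 2 <= y ^+ 3.
  rewrite -(@ler_pXn2r _ 2) ?nnegrE ?exprn_ge0 ?ler0n ?(ltW y0) //.
  rewrite -!exprM y6; apply: ler_weXn2l => //.
have Ny2 : N%:R <= y ^+ 2.
  rewrite -(@ler_pXn2r _ 3) ?nnegrE ?exprn_ge0 ?ler0n ?(ltW y0) //.
  rewrite -!exprM y6; apply: ler_weXn2l => //.
(* Rounding up gives [y < M <= y + 1], and [y + 1 <= 2 * y] because [1 <= y]. *)
exists (Num.truncn y).+1 => //; set M : R := (Num.truncn y).+1%:R.
have /andP[yM1 yM2] := truncn_itv (ltW y0).
have yM : y <= M by apply: ltW.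
have M2 : M <= 2 * y by rewrite /M -natr1; lra.
have M0 : 0 < M by lra.
have h1 : N%:R / M <= y.
  rewrite ler_pdivrMr //; apply: le_trans Ny2 _; rewrite expr2.
  by rewrite ler_wpM2l // ltW.
have h2 : N%:R ^+ 2 / M ^+ 2 <= y.
  rewrite ler_pdivrMr ?exprn_gt0 //; apply: le_trans Ny3 _; rewrite exprS.
  by rewrite ler_wpM2l ?(ltW y0) // ler_pXn2r // nnegrE ltW.
have -> : 3 * (K * (N * r))%:R / M = 3 * (K * r)%:R * (N%:R / M).
  by rewrite !natrM; ring.
have -> : 8 * K%:R * (N * r)%:R ^+ 2 / M ^+ 2 = 8 * K%:R * r%:R ^+ 2 * (N%:R ^+ 2 / M ^+ 2).
  by rewrite natrM; field; rewrite gt_eqF.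
rewrite (mulrDl (8 + _)) (mulrDl 8); apply: lerD; first apply: lerD.
- by lra.
- by rewrite ler_wpM2l // mulr_ge0.
- by rewrite ler_wpM2l // !mulr_ge0 // exprn_ge0.
Qed.

Theorem theorem7 (R : realType) (m : model R) (r : nat) :
  model_ok m -> (0 < r)%N ->
  exists C : R, forall N1 N2 : nat,
    (mK m %| N1 * r)%N -> (mK m %| N2 * r)%N ->
    (EH m N1 r + EH m N2 r - (C * ((N1 + N2)%:R `^ (5 / 6)))%:E
       <= EH m (N1 + N2) r)%E.
Proof.
move=> m_ok _.
exists (gain_bound m * (8 + 3 * (mK m * r)%:R + 8 * (mK m)%:R * r%:R ^+ 2)).
move=> N1 N2 d1 d2; rewrite !(EH_mean m_ok) -EFinN -!EFinD lee_fin.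
have [/eqP|N0] := posnP (N1 + N2).
  rewrite addn_eq0 => /andP[/eqP -> /eqP ->].
  by rewrite !mean_H0 powR0 ?mulr0 ?subr0 ?addr0 //; lra.
have [M M0 errM] := interpolation_error_le R r (mK m) N0.
have := mean_H_superadditive m_ok M0 d1 d2; apply: le_trans.
rewrite lerD2l lerN2 -[leRHS]mulrA ler_wpM2l // /gain_bound.
by rewrite !addr_ge0.
Qed.
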